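(* Let $\mathsf{F}$ be a graded field. For each coset $\Delta\in\Gamma_{\mathsf F}/2\Gamma_{\mathsf F}$ fix an element $\delta\in\Delta$ and a nonzero homogeneous element $\pi_\delta\in\mathsf{F}_\delta$ (with $\delta=0$ and $\pi_0=1$ for $\Delta=2\Gamma_{\mathsf F}$). For a nonsingular graded quadratic form $q$ on a finite-dimensional graded $\mathsf{F}$-vector space $\mathsf{V}$, let \[ q_\Delta\colon \mathsf{V}_{\frac12\delta}\to\mathsf{F}_0,\qquad x\mapsto \pi_\delta^{-1}q(x), \] which is a nonsingular quadratic form on the $\mathsf{F}_0$-vector space $\mathsf{V}_{\frac12\delta}$. Then the map that carries each nonsingular graded quadratic form $q$ to the collection of nonsingular $\mathsf{F}_0$-quadratic forms $(q_\Delta)_{\Delta\in\Gamma_{\mathsf F}/2\Gamma_{\mathsf F}}$ defines a group isomorphism \[ I_q(\mathsf{F})\stackrel{\sim}{\to}\bigoplus_{\Gamma_{\mathsf F}/2\Gamma_{\mathsf F}} I_q(\mathsf{F}_0). \] This isomorphism depends on the choice of the homogeneous elements $\pi_\delta\in\mathsf{F}_\delta$.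
   Context: Let $\Gamma$ be a divisible torsion-free abelian group containing the degrees of all graded structures. A graded field is a $\Gamma$-graded commutative ring $\mathsf{F}=\bigoplus_{\gamma\in\Gamma}\mathsf{F}_\gamma$ in which every nonzero homogeneous element is invertible; a graded vector space over $\mathsf{F}$ is a graded $\mathsf{F}$-module $\mathsf{V}=\bigoplus_{\gamma}\mathsf{V}_\gamma$ (such modules are free, and the rank is called the dimension). $\Gamma_{\mathsf F}=\{\gamma\in\Gamma\mid\mathsf{F}_\gamma\neq\{0\}\}$ is a subgroup of $\Gamma$, and $\mathsf{F}_0$ is a field. A graded quadratic form on a finite-dimensional graded $\mathsf{F}$-vector space $\mathsf{V}$ is a map $q\colon\mathsf{V}\to\mathsf{F}$ with $q(xa)=q(x)a^2$ for $x\in\mathsf V$, $a\in\mathsf F$, whose polar form $b(x,y)=q(x+y)-q(x)-q(y)$ is $\mathsf{F}$-bilinear, and such that $q(\mathsf{V}_\gamma)\subseteq\mathsf{F}_{2\gamma}$ and $b(\mathsf{V}_\gamma,\mathsf{V}_\delta)\subseteq\mathsf{F}_{\gamma+\delta}$ for all $\gamma,\delta\in\Gamma$. It is nonsingular if $b$ is nondegenerate (only $x=0$ satisfies $b(x,y)=0$ for all $y\in\mathsf V$), and hyperbolic if it is nonsingular and $\mathsf{V}=\mathsf{U}\oplus\mathsf{W}$ for graded subspaces with $q(\mathsf{U})=q(\mathsf{W})=\{0\}$. $I_q(\mathsf{F})$ is the quadratic Witt group of $\mathsf F$: Witt-equivalence classes (isometry up to adding hyperbolic forms) of even-dimensional nonsingular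 graded quadratic forms over $\mathsf{F}$, with orthogonal sum as group operation. Likewise, for a field $k$, $I_q(k)$ is the group of Witt-equivalence classes of even-dimensional nonsingular quadratic forms over $k$ (nonsingular meaning that the polar form is nondegenerate).
   Formalization: For even-dimensional I_q the map is undefined if 2≠0 and Γ_F≠2Γ_F (residues can be odd-dimensional); proved for Witt groups of all nonsingular forms, and for I_q when 2=0 or Γ_F=2Γ_F. Dependence on π_δ is shown by an example in the former setting. *)

(* Defs.v *)
From HB Require Import structures.
From mathcomp Require Import all_boot all_algebra.
From mathcomp Require Import ring.
From mathcomp Require Import boolp classical_sets cardinality.

Set Implicit Arguments.
Unset Strict Implicit.
Unset Printing Implicit Defensive.

Import GRing.Theory.

Local Open Scope ring_scope.

(* Isometry classes of forms on arbitrary modules do not fit in the universe  *)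
(* of the carriers of the library's algebraic structures, so Witt groups      *)
(* cannot be instances of zmodType; hence the following bare structures.      *)
Record comMonoid := ComMonoid {
  cm_car :> Type;
  cm_zero : cm_car;
  cm_add : cm_car -> cm_car -> cm_car;
  cm_addA : associative cm_add;
  cm_addC : commutative cm_add;
  cm_add0 : left_id cm_zero cm_add
}.
Arguments cm_zero {c}.
Arguments cm_add {c}.

(* A commutative monoid is a group as soon as inverses exist.                 *)
Definition is_abelian_group (M : comMonoid) : Prop :=
  forall x : M, exists y : M, cm_add x y = cm_zero.

Definition is_group_isomorphism (M N : comMonoid) (f : M -> N) : Prop :=
  [/\ is_abelian_group M, is_abelian_group N, bijective f
    & forall x y, f (cm_add x y) = cm_add (f x) (f y)].

Section DirectSum.
Variables (I : Type) (M : comMonoid).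

Definition fin_supp (f : I -> M) : Prop :=
  finite_set [set i | f i <> cm_zero]%classic.

Definition dsum_car := {f : I -> M | fin_supp f}.

Lemma fin_supp0 : fin_supp (fun=> cm_zero).
Proof.
by rewrite /fin_supp (_ : [set i | _]%classic = set0) // -subset0 => i /=.
Qed.

Lemma fin_suppD f g :
  fin_supp f -> fin_supp g -> fin_supp (fun i => cm_add (f i) (g i)).
Proof.
move=> ff fg; have := conj ff fg; rewrite /fin_supp -finite_setU.
apply: sub_finite_set => i /= fgN0.
have [f0|] := EM (f i = cm_zero); last by left.
by right=> g0; apply: fgN0; rewrite f0 g0 cm_add0.
Qed.

Definition dsum_zero : dsum_car := exist _ _ fin_supp0.
Definition dsum_add (f g : dsum_car) : dsum_car :=
  exist _ _ (fin_suppD (svalP f) (svalP g)).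

Lemma dsum_eq (f g : dsum_car) : (forall i, sval f i = sval g i) -> f = g.
Proof.
by case: f g => [f ff] [g fg] /= fg_eq; apply: eq_exist; apply/funext.
Qed.

Fact dsum_addA : associative dsum_add.
Proof. by move=> f g h; apply: dsum_eq => i /=; rewrite cm_addA. Qed.
Fact dsum_addC : commutative dsum_add.
Proof. by move=> f g; apply: dsum_eq => i /=; rewrite cm_addC. Qed.
Fact dsum_add0 : left_id dsum_zero dsum_add.
Proof. by move=> f; apply: dsum_eq => i /=; rewrite cm_add0. Qed.

Definition direct_sum := ComMonoid dsum_addA dsum_addC dsum_add0.

Definition dsum_coord (f : direct_sum) (i : I) : M := sval f i.

End DirectSum.

(* The Witt construction, shared by the graded and the ungraded setting.      *)
Record formSystem := FormSystem {
  fs_form :> Type;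
  fs_isometric : fs_form -> fs_form -> Prop;
  fs_sum : fs_form -> fs_form -> fs_form;
  fs_zero : fs_form;
  fs_hyperbolic : fs_form -> Prop;
  fs_isom_refl : forall q, fs_isometric q q;
  fs_isom_sym : forall q r, fs_isometric q r -> fs_isometric r q;
  fs_isom_trans :
    forall q r s, fs_isometric q r -> fs_isometric r s -> fs_isometric q s;
  fs_isom_sum : forall q q' r r', fs_isometric q q' -> fs_isometric r r' ->
    fs_isometric (fs_sum q r) (fs_sum q' r');
  fs_sumA : forall q r s,
    fs_isometric (fs_sum q (fs_sum r s)) (fs_sum (fs_sum q r) s);
  fs_sumC : forall q r, fs_isometric (fs_sum q r) (fs_sum r q);
  fs_sum0 : forall q, fs_isometric (fs_sum fs_zero q) q;
  fs_hyperbolic0 : fs_hyperbolic fs_zero;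
  fs_hyperbolicD : forall q r,
    fs_hyperbolic q -> fs_hyperbolic r -> fs_hyperbolic (fs_sum q r)
}.

Section WittGroup.
Variable S : formSystem.
Implicit Types q r s h : S.

Local Notation "q ~~~ r" := (fs_isometric q r) (at level 70).
Local Notation "q _|_ r" := (fs_sum q r) (at level 50).

Definition witt_equiv q r : Prop :=
  exists h h', [/\ fs_hyperbolic h, fs_hyperbolic h' & q _|_ h ~~~ r _|_ h'].

Definition witt_car := {A : S -> Prop | exists q, A = witt_equiv q}.

Definition witt_class q : witt_car :=
  exist _ (witt_equiv q) (ex_intro _ q erefl).

Definition witt_repr (w : witt_car) : S := sval (cid (svalP w)).

Lemma witt_equiv_refl q : witt_equiv q q.
Proof.
exists (fs_zero S), (fs_zero S); split; try exact: fs_hyperbolic0.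
exact: fs_isom_refl.
Qed.

Lemma witt_equiv_sym q r : witt_equiv q r -> witt_equiv r q.
Proof. by case=> h [h'] [? ? /fs_isom_sym ?]; exists h', h; split. Qed.

Lemma fs_sumAC q r s : (q _|_ r) _|_ s ~~~ (q _|_ s) _|_ r.
Proof.
apply: fs_isom_trans (fs_isom_sym (fs_sumA _ _ _)) _.
apply: fs_isom_trans (fs_sumA _ _ _).
exact: fs_isom_sum (fs_isom_refl _) (fs_sumC _ _).
Qed.

Lemma witt_equiv_trans q r s :
  witt_equiv q r -> witt_equiv r s -> witt_equiv q s.
Proof.
case=> h1 [h2] [Hh1 Hh2 qr] [k1] [k2] [Hk1 Hk2 rs].
exists (h1 _|_ k1), (k2 _|_ h2); split; try exact: fs_hyperbolicD.
apply: fs_isom_trans (fs_sumA _ _ _) _.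
apply: fs_isom_trans (fs_isom_sum qr (fs_isom_refl k1)) _.
apply: fs_isom_trans (fs_sumAC _ _ _) _.
apply: fs_isom_trans (fs_isom_sum rs (fs_isom_refl h2)) _.
exact: fs_isom_sym (fs_sumA _ _ _).
Qed.

Lemma witt_equiv_isom q r : q ~~~ r -> witt_equiv q r.
Proof.
exists (fs_zero S), (fs_zero S); split; try exact: fs_hyperbolic0.
exact: fs_isom_sum (fs_isom_refl _).
Qed.

Lemma fs_sumACA q q' r r' :
  (q _|_ q') _|_ (r _|_ r') ~~~ (q _|_ r) _|_ (q' _|_ r').
Proof.
apply: fs_isom_trans (fs_sumA _ _ _) _.
apply: fs_isom_trans (fs_isom_sym (fs_sumA _ _ _)).
exact: fs_isom_sum (fs_sumAC _ _ _) (fs_isom_refl _).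
Qed.

Lemma witt_equivD q q' r r' :
  witt_equiv q q' -> witt_equiv r r' -> witt_equiv (q _|_ r) (q' _|_ r').
Proof.
case=> h1 [h2] [Hh1 Hh2 qq] [k1] [k2] [Hk1 Hk2 rr].
exists (h1 _|_ k1), (h2 _|_ k2); split; try exact: fs_hyperbolicD.
apply: fs_isom_trans (fs_sumACA _ _ _ _) _.
apply: fs_isom_trans (fs_sumACA _ _ _ _).
exact: fs_isom_sum.
Qed.

Lemma witt_class_eq q r : witt_class q = witt_class r <-> witt_equiv q r.
Proof.
split=> [[/(congr1 (@^~ r)) ->]|qr]; first exact: witt_equiv_refl.
apply: eq_exist; apply/funext => s; apply/propext; split.
  exact: witt_equiv_trans (witt_equiv_sym qr).
exact: witt_equiv_trans.
Qed.

Lemma witt_reprK w : witt_class (witt_repr w) = w.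
Proof.
rewrite /witt_repr; case: cid => q /= Eq.
by case: w Eq => A pA /= Eq; apply: eq_exist; rewrite Eq.
Qed.

Definition witt_zero : witt_car := witt_class (fs_zero S).

Definition witt_add (v w : witt_car) : witt_car :=
  witt_class (witt_repr v _|_ witt_repr w).

Lemma witt_classD q r :
  witt_class (q _|_ r) = witt_add (witt_class q) (witt_class r).
Proof.
apply/witt_class_eq; apply: witt_equivD;
by apply/witt_class_eq; rewrite witt_reprK.
Qed.

Fact witt_addA : associative witt_add.
Proof.
move=> u v w; rewrite -(witt_reprK u) -(witt_reprK v) -(witt_reprK w).
rewrite -!witt_classD; apply/witt_class_eq/witt_equiv_isom; exact: fs_sumA.
Qed.

Fact witt_addC : commutative witt_add.
Proof.
by move=> u v; apply/witt_class_eq/witt_equiv_isom; exact: fs_sumC.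
Qed.

Fact witt_add0 : left_id witt_zero witt_add.
Proof.
move=> u; rewrite -(witt_reprK u) -witt_classD.
by apply/witt_class_eq/witt_equiv_isom; exact: fs_sum0.
Qed.

Definition witt_group := ComMonoid witt_addA witt_addC witt_add0.

End WittGroup.

Section QuadraticForms.
Variable R : comNzRingType.

Definition polar (V : lmodType R) (q : V -> R) (x y : V) : R :=
  q (x + y) - q x - q y.

Definition is_quadratic_form (V : lmodType R) (q : V -> R) : Prop :=
  (forall (a : R) (x : V), q (a *: x) = q x * a ^+ 2) /\
  (forall y : V, scalar (polar q y) /\ scalar (polar q ^~ y)).

Definition nonsingular (V : lmodType R) (q : V -> R) : Prop :=
  forall x : V, (forall y, polar q x y = 0) -> x = 0.

Definition is_basis (V : lmodType R) (n : nat) (e : 'I_n -> V) : Prop :=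
  forall x : V, exists! c : {ffun 'I_n -> R}, x = \sum_i c i *: e i.

Definition has_dim (V : lmodType R) (n : nat) : Prop :=
  exists e : 'I_n -> V, is_basis e.

(* Nonsingular and finite-dimensional, and moreover even-dimensional when     *)
(* even = true.  Witt groups with even = true are the groups I_q; those with  *)
(* even = false also contain the classes of odd-dimensional forms, which only *)
(* exist when 2 is invertible.  The latter are needed because there an        *)
(* even-dimensional graded form can have odd-dimensional residues, e.g.       *)
(* x ^+ 2 + t * y ^+ 2 over k[t, t^-1].                                       *)
Definition admissible (even : bool) (V : lmodType R) (q : V -> R) : Prop :=
  nonsingular q /\ exists n, has_dim V n /\ (even -> ~~ odd n).

Definition is_isometry (V W : lmodType R) (q : V -> R) (r : W -> R)
    (f : V -> W) : Prop :=
  [/\ linear f, bijective f & forall x, r (f x) = q x].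

Definition orth_sum (V W : lmodType R) (q : V -> R) (r : W -> R) :
  V * W -> R := fun x => q x.1 + r x.2.

Definition is_direct_decomposition (V : lmodType R) (U W : {pred V}) : Prop :=
  [/\ submod_closed U, submod_closed W,
      forall x, exists u w, [/\ u \in U, w \in W & x = u + w]
    & forall x, x \in U -> x \in W -> x = 0].

Definition vanishes_on (V : lmodType R) (q : V -> R) (U : {pred V}) : Prop :=
  forall x, x \in U -> q x = 0.

End QuadraticForms.

Section QuadraticFormsTheory.
Variable R : comNzRingType.
Implicit Types U V W : lmodType R.

Lemma polarC V (q : V -> R) x y : polar q x y = polar q y x.
Proof. by rewrite /polar (addrC x) addrAC. Qed.

Lemma quadratic0 V (q : V -> R) : is_quadratic_form q -> q 0 = 0.
Proof. by case=> qZ _; rewrite -(scale0r 0) qZ expr0n mulr0. Qed.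

Lemma is_quadratic_formP V (q : V -> R) :
  (forall (a : R) x, q (a *: x) = q x * a ^+ 2) ->
  (forall y, scalar (polar q y)) -> is_quadratic_form q.
Proof.
move=> qZ qB; split=> // y; split=> // a x z.
by rewrite /= !(polarC q _ y) qB.
Qed.

Lemma polar_orth_sum V W (q : V -> R) (r : W -> R) x y :
  polar (orth_sum q r) x y = polar q x.1 y.1 + polar r x.2 y.2.
Proof.
rewrite /polar /orth_sum -[(x + y).1]/(x.1 + y.1) -[(x + y).2]/(x.2 + y.2).
ring.
Qed.

Lemma orth_sum_quadratic V W (q : V -> R) (r : W -> R) :
  is_quadratic_form q -> is_quadratic_form r ->
  is_quadratic_form (orth_sum q r).
Proof.
move=> [qZ qB] [rZ rB]; apply: is_quadratic_formP => [a x|y a x z].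
  by rewrite /orth_sum /= qZ rZ mulrDl.
rewrite !polar_orth_sum /= (qB y.1).1 (rB y.2).1 /=; ring.
Qed.

Lemma orth_sum_nonsingular V W (q : V -> R) (r : W -> R) :
  is_quadratic_form q -> is_quadratic_form r ->
  nonsingular q -> nonsingular r -> nonsingular (orth_sum q r).
Proof.
move=> Qq Qr nq nr [x1 x2] xP.
have q0 z : polar q z 0 = 0 by rewrite /polar quadratic0 // addr0 subrr subr0.
have r0 z : polar r z 0 = 0 by rewrite /polar quadratic0 // addr0 subrr subr0.
congr (_, _).
  by apply: nq => y; have := xP (y, 0); rewrite polar_orth_sum /= r0 addr0.
by apply: nr => y; have := xP (0, y); rewrite polar_orth_sum /= q0 add0r.
Qed.

Lemma has_dim_prod V W m n :
  has_dim V m -> has_dim W n -> has_dim (V * W)%type (m + n).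
Proof.
move=> [e eP] [f fP].
pose g (i : 'I_(m + n)) : V * W :=
  match split i with inl j => (e j, 0) | inr j => (0, f j) end.
have gl j : g (lshift n j) = (e j, 0) by rewrite /g -[lshift n j]/(unsplit (inl j)) unsplitK.
have gr j : g (rshift m j) = (0, f j) by rewrite /g -[rshift m j]/(unsplit (inr j)) unsplitK.
have gsum (c : 'I_(m + n) -> R) : \sum_i c i *: g i =
    (\sum_i c (lshift n i) *: e i, \sum_i c (rshift m i) *: f i).
  rewrite big_split_ord /=.
  under eq_bigr do rewrite gl.
  under [X in _ + X]eq_bigr do rewrite gr.
  rewrite [LHS]surjective_pairing /= !raddf_sum /=.
  congr (_, _).
    rewrite -[RHS]addr0; congr (_ + _); apply: big1 => i _.
    by rewrite scaler0.
  rewrite -[RHS]add0r; congr (_ + _); apply: big1 => i _.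
  by rewrite scaler0.
exists g => -[x y].
have [a [xE aU]] := eP x; have [b [yE bU]] := fP y.
exists [ffun i => match split i with inl j => a j | inr j => b j end].
have cl j : [ffun i => match split i with inl j => a j | inr j => b j end]
    (lshift n j) = a j.
  by rewrite ffunE -[lshift n j]/(unsplit (inl j)) unsplitK.
have cr j : [ffun i => match split i with inl j => a j | inr j => b j end]
    (rshift m j) = b j.
  by rewrite ffunE -[rshift m j]/(unsplit (inr j)) unsplitK.
split.
  rewrite gsum xE yE; congr (_, _); apply: eq_bigr => i _; last by rewrite cr.
  by rewrite cl.
move=> c; rewrite gsum => -[xE' yE'].
have -> : a = [ffun i => c (lshift n i)].
  by apply: aU; rewrite xE'; apply: eq_bigr => i _; rewrite ffunE.
have -> : b = [ffun i => c (rshift m i)].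
  by apply: bU; rewrite yE'; apply: eq_bigr => i _; rewrite ffunE.
apply/ffunP => i; rewrite ffunE -{2}(splitK i).
by case: (split i) => j /=; rewrite ffunE.
Qed.

Lemma has_dim_triv : has_dim 'rV[R]_0 0.
Proof.
exists (fun=> 0) => x; exists [ffun=> 0]; split; first by rewrite big_ord0 thinmx0.
by move=> c _; apply/ffunP => -[].
Qed.

Lemma zero_quadratic V : is_quadratic_form (fun _ : V => 0 : R).
Proof.
apply: is_quadratic_formP => [a x|y a x z]; first by rewrite mul0r.
by rewrite /polar; ring.
Qed.

Lemma admissible_triv even : admissible even (fun _ : 'rV[R]_0 => 0).
Proof.
split=> [x _|]; first by rewrite thinmx0.
by exists 0; split=> //; exact: has_dim_triv.
Qed.

Lemma admissible_orth_sum even V W (q : V -> R) (r : W -> R) :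
  is_quadratic_form q -> is_quadratic_form r ->
  admissible even q -> admissible even r -> admissible even (orth_sum q r).
Proof.
move=> Qq Qr [nq [m [dm em]]] [nr [n [dn en]]].
split; first exact: orth_sum_nonsingular.
exists (m + n); split; first exact: has_dim_prod.
by move=> ev; rewrite oddD (negPf (em ev)) (negPf (en ev)).
Qed.

Lemma isometry_id V (q : V -> R) : is_isometry q q id.
Proof. by split=> //; exists id. Qed.

Lemma isometry_inv V W (q : V -> R) (r : W -> R) f g :
  cancel f g -> cancel g f -> is_isometry q r f -> is_isometry r q g.
Proof.
move=> fK gK [fl fb fq]; split; last by move=> x; rewrite -fq gK.
  by move=> a x y; apply: (can_inj fK); rewrite fl !gK.
by exists f.
Qed.

Lemma isometry_comp U V W (p : U -> R) (q : V -> R) (r : W -> R) f g :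
  is_isometry p q f -> is_isometry q r g -> is_isometry p r (g \o f).
Proof.
move=> [fl fb fq] [gl gb gq]; split; last by move=> x /=; rewrite gq fq.
  by move=> a x y /=; rewrite fl gl.
exact: bij_comp.
Qed.

Lemma isometry_sum V V' W W' (q : V -> R) (q' : V' -> R) (r : W -> R)
    (r' : W' -> R) f g :
  is_isometry q q' f -> is_isometry r r' g ->
  is_isometry (orth_sum q r) (orth_sum q' r') (fun x => (f x.1, g x.2)).
Proof.
move=> [fl [f' fK f'K] fq] [gl [g' gK g'K] gq]; split.
- by move=> a x y; rewrite /= fl gl.
- by exists (fun x => (f' x.1, g' x.2)) => -[x y] /=; rewrite ?fK ?gK ?f'K ?g'K.
- by move=> x; rewrite /orth_sum /= fq gq.
Qed.

Lemma isometry_sumA U V W (p : U -> R) (q : V -> R) (r : W -> R) :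
  is_isometry (orth_sum p (orth_sum q r)) (orth_sum (orth_sum p q) r)
    (fun x => ((x.1, x.2.1), x.2.2)).
Proof.
split=> //; last by move=> x; rewrite /orth_sum /= addrA.
by exists (fun x => (x.1.1, (x.1.2, x.2))) => [[x [y z]]|[[x y] z]].
Qed.

Lemma isometry_sumC V W (q : V -> R) (r : W -> R) :
  is_isometry (orth_sum q r) (orth_sum r q) (fun x => (x.2, x.1)).
Proof.
split=> //; last by move=> x; rewrite /orth_sum /= addrC.
by exists (fun x => (x.2, x.1)) => -[].
Qed.

Lemma isometry_sum0 V (q : V -> R) :
  is_isometry (orth_sum (fun _ : 'rV[R]_0 => 0) q) q snd.
Proof.
split=> //; last by move=> x; rewrite /orth_sum add0r.
by exists (fun x => (0, x)) => [[x y]|x] //=; rewrite (thinmx0 x).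
Qed.

Definition predX V W (A : {pred V}) (B : {pred W}) : {pred V * W} :=
  [pred x | (x.1 \in A) && (x.2 \in B)].

Lemma submod_closedX V W (A : {pred V}) (B : {pred W}) :
  submod_closed A -> submod_closed B -> submod_closed (predX A B).
Proof.
move=> [A0 Al] [B0 Bl]; split; first by rewrite !inE /= A0 B0.
move=> a x y; rewrite !inE /= => /andP[xA xB] /andP[yA yB].
by rewrite Al ?Bl.
Qed.

Lemma direct_decompositionX V W (A A' : {pred V}) (B B' : {pred W}) :
  is_direct_decomposition A A' -> is_direct_decomposition B B' ->
  is_direct_decomposition (predX A B) (predX A' B').
Proof.
move=> [A1 A2 A3 A4] [B1 B2 B3 B4]; split; try exact: submod_closedX.
  move=> [x y]; have [u [u' [uA uA' ->]]] := A3 x.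
  have [v [v' [vB vB' ->]]] := B3 y.
  by exists (u, v), (u', v'); rewrite !inE /= uA uA' vB vB'.
move=> [x y]; rewrite !inE /= => /andP[xA yB] /andP[xA' yB'].
by have -> : x = 0 by [exact: A4]; have -> : y = 0 by [exact: B4].
Qed.

Lemma vanishes_onX V W (q : V -> R) (r : W -> R) A B :
  vanishes_on q A -> vanishes_on r B -> vanishes_on (orth_sum q r) (predX A B).
Proof.
move=> qA rB [x y]; rewrite !inE /orth_sum /= => /andP[/qA -> /rB ->].
by rewrite addr0.
Qed.

Lemma direct_decomposition_triv :
  is_direct_decomposition (xpredT : {pred 'rV[R]_0}) xpredT.
Proof.
by split=> // x; rewrite ?(thinmx0 x) //; exists 0, 0; rewrite addr0.
Qed.

End QuadraticFormsTheory.

Section UngradedForms.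
Variable k : fieldType.

Record quadSpace := QuadSpace {
  qs_mod :> lmodType k;
  qs_form : qs_mod -> k;
  qs_quadratic : is_quadratic_form qs_form
}.

Definition qs_zero : quadSpace := QuadSpace (@zero_quadratic k 'rV_0).

Definition qs_sum (q r : quadSpace) : quadSpace :=
  QuadSpace (orth_sum_quadratic (qs_quadratic q) (qs_quadratic r)).

Definition qs_isometric (q r : quadSpace) : Prop :=
  exists f : q -> r, is_isometry (@qs_form q) (@qs_form r) f.

Definition qs_hyperbolic (q : quadSpace) : Prop :=
  nonsingular (@qs_form q) /\
  exists U W : {pred q}, [/\ is_direct_decomposition U W,
    vanishes_on (@qs_form q) U & vanishes_on (@qs_form q) W].

Variable even : bool.

Definition qs_adm (q : quadSpace) : Prop := admissible even (@qs_form q).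

Definition nsForm := {q : quadSpace | qs_adm q}.

Definition nsForm_zero : nsForm := exist _ qs_zero (@admissible_triv k even).

Definition nsForm_sum (q r : nsForm) : nsForm :=
  exist _ (qs_sum (sval q) (sval r))
    (admissible_orth_sum (qs_quadratic (sval q)) (qs_quadratic (sval r))
       (svalP q) (svalP r)).

Definition nsForm_isometric (q r : nsForm) := qs_isometric (sval q) (sval r).
Definition nsForm_hyperbolic (q : nsForm) := qs_hyperbolic (sval q).

Fact nsForm_isom_refl q : nsForm_isometric q q.
Proof. by exists id; exact: isometry_id. Qed.

Fact nsForm_isom_sym q r : nsForm_isometric q r -> nsForm_isometric r q.
Proof.
by move=> [f fP]; have [_ [g fK gK] _] := fP; exists g; exact: isometry_inv fP.
Qed.

Fact nsForm_isom_trans q r s :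
  nsForm_isometric q r -> nsForm_isometric r s -> nsForm_isometric q s.
Proof. by move=> [f fP] [g gP]; exists (g \o f); exact: isometry_comp gP. Qed.

Fact nsForm_isom_sum q q' r r' :
  nsForm_isometric q q' -> nsForm_isometric r r' ->
  nsForm_isometric (nsForm_sum q r) (nsForm_sum q' r').
Proof.
move=> [f fP] [g gP].
by exists (fun x => (f x.1, g x.2)); exact: isometry_sum.
Qed.

Fact nsForm_sumA q r s : nsForm_isometric
  (nsForm_sum q (nsForm_sum r s)) (nsForm_sum (nsForm_sum q r) s).
Proof. by exists (fun x => ((x.1, x.2.1), x.2.2)); exact: isometry_sumA. Qed.

Fact nsForm_sumC q r : nsForm_isometric (nsForm_sum q r) (nsForm_sum r q).
Proof. by exists (fun x => (x.2, x.1)); exact: isometry_sumC. Qed.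

Fact nsForm_sum0 q : nsForm_isometric (nsForm_sum nsForm_zero q) q.
Proof. by exists snd; exact: isometry_sum0. Qed.

Fact nsForm_hyperbolic0 : nsForm_hyperbolic nsForm_zero.
Proof.
split; first by case: (admissible_triv k even).
exists xpredT, xpredT; split=> //; exact: direct_decomposition_triv.
Qed.

Fact nsForm_hyperbolicD q r :
  nsForm_hyperbolic q -> nsForm_hyperbolic r ->
  nsForm_hyperbolic (nsForm_sum q r).
Proof.
move=> [nq [U [W [qUW qU qW]]]] [nr [U' [W' [rUW rU rW]]]].
split; first by apply: orth_sum_nonsingular => //; exact: qs_quadratic.
exists (predX U U'), (predX W W'); split; try exact: vanishes_onX.
exact: direct_decompositionX.
Qed.

Definition nsForm_system : formSystem :=
  FormSystem nsForm_isom_refl nsForm_isom_sym nsForm_isom_trans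
    nsForm_isom_sum nsForm_sumA nsForm_sumC nsForm_sum0
    nsForm_hyperbolic0 nsForm_hyperbolicD.

End UngradedForms.

HB.mixin Record isDivisibleTorsionFree G of GRing.Zmodule G := {
  divisible : forall (n : nat) (x : G), (0 < n)%N -> exists y : G, y *+ n = x;
  torsion_free : forall (n : nat) (x : G), (0 < n)%N -> x *+ n = 0 -> x = 0
}.

#[short(type="dtfGroupType")]
HB.structure Definition DivTorsionFree :=
  { G of isDivisibleTorsionFree G & GRing.Zmodule G }.

Section Half.
Variable G : dtfGroupType.

Definition half (x : G) : G := sval (cid (@divisible G 2 x isT)).

Lemma halfK x : half x *+ 2 = x.
Proof. by rewrite /half; case: cid. Qed.

(* Torsion-freeness makes half x the only solution of y *+ 2 = x.             *)
Lemma half_unique x y : y *+ 2 = x -> y = half x.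
Proof.
move=> yx; apply/eqP; rewrite -subr_eq0; apply/eqP.
by apply: (@torsion_free G 2) => //; rewrite mulrnBl yx halfK subrr.
Qed.

End Half.

Section Graded.
Variable G : dtfGroupType.

(* V is the internal direct sum of the C g.                                   *)
Definition is_grading (V : zmodType) (C : G -> {pred V}) : Prop :=
  [/\ forall g, zmod_closed (C g),
      forall x, exists (s : seq G) (f : G -> V),
        [/\ uniq s, forall g, f g \in C g & x = \sum_(g <- s) f g]
    & forall (s : seq G) (f : G -> V), uniq s -> (forall g, f g \in C g) ->
        \sum_(g <- s) f g = 0 -> forall g, g \in s -> f g = 0].

Lemma sum_mask (V : zmodType) (s t : seq G) (f : G -> V) :
  uniq s -> uniq t -> {subset s <= t} ->
  \sum_(g <- s) f g = \sum_(g <- t) (if g \in s then f g else 0).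
Proof.
move=> us ut st; rewrite [RHS](bigID (mem s)) /= [X in _ + X]big1 ?addr0.
  rewrite -[RHS]big_filter [RHS](eq_big_seq f); last first.
    by move=> h; rewrite mem_filter => /andP[hs _]; rewrite (hs : h \in s).
  apply/perm_big/uniq_perm => //; first exact: filter_uniq.
  move=> h; rewrite mem_filter; apply/idP/andP => [hs|[]//].
  by split=> //; exact: st.
by move=> h /negPf hs; rewrite hs.
Qed.

Record gradedField := GradedField {
  gf_ring :> comUnitRingType;
  gf_comp : G -> {pred gf_ring};
  gf_grading : is_grading gf_comp;
  gf_one : 1 \in gf_comp 0;
  gf_mul : forall g h x y,
    x \in gf_comp g -> y \in gf_comp h -> x * y \in gf_comp (g + h);
  gf_unit : forall g x, x \in gf_comp g -> x != 0 -> x \is a GRing.unit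
}.

Arguments gf_comp : clear implicits.

Section GradedFieldTheory.
Variable F : gradedField.
Implicit Types (x y : F) (g h : G).

Definition grade_set : set G :=
  [set g | exists2 x : F, x \in gf_comp F g & x != 0]%classic.

Lemma gf_inv g x : x \in gf_comp F g -> x != 0 -> x^-1 \in gf_comp F (- g).
Proof.
move=> xg x0; have ux := gf_unit xg x0.
have [Czmod span indep] := gf_grading F.
have C0 h : 0 \in gf_comp F h by case: (Czmod h).
have CB h y z : y \in gf_comp F h -> z \in gf_comp F h -> y - z \in gf_comp F h.
  by case: (Czmod h) => _; exact.
have [s [f [us fC xV]]] := span x^-1.
pose t := undup (- g :: s).
pose f1 h := if h \in s then f h else 0.
have f1C h : f1 h \in gf_comp F h by rewrite /f1; case: ifP.
have ut : uniq t by exact: undup_uniq.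
have gt : - g \in t by rewrite mem_undup mem_head.
have xV1 : x^-1 = \sum_(h <- t) f1 h.
  rewrite xV; apply: sum_mask => // h hs.
  by rewrite mem_undup inE hs orbT.
pose d h := x * f1 (h - g) - (if h == 0 then 1 else 0).
have dC h : d h \in gf_comp F h.
  apply: CB; last by case: eqP => [->|_] /=; rewrite ?gf_one ?C0.
  by have := gf_mul xg (f1C (h - g)); rewrite (addrC g) subrK.
have d0 : \sum_(h <- [seq h + g | h <- t]) d h = 0.
  rewrite big_map sumrB -[X in _ - X](_ : x * x^-1 = _); last first.
    rewrite divrr // (big_rem (- g)) //= addNr eqxx.
    rewrite big1_seq ?addr0 // => h /=; rewrite mem_rem_uniq // inE => /andP[hg _].
    by rewrite addr_eq0 (negPf hg).
  under eq_bigr do rewrite addrK.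
  by rewrite -mulr_sumr -xV1 subrr.
have um : uniq [seq h + g | h <- t] by rewrite map_inj_uniq //; exact: addIr.
have f10 h : h \in t -> h != - g -> f1 h = 0.
  move=> ht hg; have := indep _ _ um dC d0 (h + g) (map_f _ ht).
  rewrite /d addrK addr_eq0 (negPf hg) subr0 => xf.
  by rewrite -[f1 h](mulKr ux) xf mulr0.
rewrite xV1 (big_rem (- g)) //= big1_seq ?addr0 // => h /=.
by rewrite mem_rem_uniq // inE => /andP[hg ht]; exact: f10.
Qed.

Definition degree0 : {pred F} := gf_comp F 0.

Fact degree0_divring_closed : divring_closed degree0.
Proof.
have [Czmod _ _] := gf_grading F; have [C0 CB] := Czmod 0.
split=> [||x y x0 y0]; [exact: gf_one | exact: CB |].
rewrite /degree0 -[0](addr0 0); apply: gf_mul => //.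
have [->|yN0] := eqVneq y 0; first by rewrite invr0.
by rewrite -oppr0; exact: gf_inv.
Qed.
HB.instance Definition _ :=
  GRing.isDivringClosed.Build F degree0 degree0_divring_closed.

Record F0 := Degree0 { F0_val : F; F0_valP : F0_val \in degree0 }.

HB.instance Definition _ := [isSub for F0_val].
HB.instance Definition _ := [Choice of F0 by <:].
HB.instance Definition _ := [SubChoice_isSubComUnitRing of F0 by <:].

Fact F0_field : GRing.field_axiom F0.
Proof.
move=> x xN0.
have vN0 : val x != 0 by apply: contraNneq xN0 => v0; apply/eqP/val_inj.
have xV : (val x)^-1 \in degree0.
  by have := gf_inv (valP x) vN0; rewrite oppr0.
have xu : val x \is a GRing.unit by exact: gf_unit (valP x) vN0.
apply/unitrP; exists (Degree0 xV).
by split; apply: val_inj; rewrite /= ?mulVr ?mulrV.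
Qed.

HB.instance Definition _ := GRing.ComUnitRing_isField.Build F0 F0_field.

End GradedFieldTheory.

Section GradedSpaces.
Variable F : gradedField.

Record gradedSpace := GradedSpace {
  gs_mod :> lmodType F;
  gs_comp : G -> {pred gs_mod};
  gs_grading : is_grading gs_comp;
  gs_scale : forall g h (a : F) (x : gs_mod),
    a \in gf_comp F g -> x \in gs_comp h -> a *: x \in gs_comp (g + h)
}.

Arguments gs_comp : clear implicits.

Definition is_graded_map (V W : gradedSpace) (f : V -> W) : Prop :=
  forall g x, (f x \in gs_comp W g) = (x \in gs_comp V g).

(* The subspace U is spanned by its homogeneous elements.                     *)
Definition is_graded_subspace (V : gradedSpace) (U : {pred V}) : Prop :=
  forall x, x \in U -> exists (s : seq G) (f : G -> V),
    [/\ uniq s, forall g, f g \in gs_comp V g, forall g, f g \in U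
      & x = \sum_(g <- s) f g].

Section HomogeneousComponent.
Variables (V : gradedSpace) (g : G).

Definition homog : {pred V} := gs_comp V g.

Fact homog_zmod_closed : zmod_closed homog.
Proof. by case: (gs_grading V) => /(_ g). Qed.
HB.instance Definition _ := GRing.isZmodClosed.Build V homog homog_zmod_closed.

Record homogComp := HomogComp { hc_val : V; hc_valP : hc_val \in homog }.

HB.instance Definition _ := [isSub for hc_val].
HB.instance Definition _ := [Choice of homogComp by <:].
HB.instance Definition _ := [SubChoice_isSubZmodule of homogComp by <:].

Fact hc_scale_subproof (a : F0 F) (x : homogComp) : val a *: val x \in homog.
Proof. by have := gs_scale (valP a) (valP x); rewrite add0r. Qed.

Definition hc_scale (a : F0 F) (x : homogComp) : homogComp :=
  HomogComp (hc_scale_subproof a x).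

Fact hc_scaleA a b x : hc_scale a (hc_scale b x) = hc_scale (a * b) x.
Proof. by apply: val_inj; rewrite /= scalerA. Qed.
Fact hc_scale1 : left_id 1 hc_scale.
Proof. by move=> x; apply: val_inj; rewrite /= scale1r. Qed.
Fact hc_scaleDr : right_distributive hc_scale +%R.
Proof. by move=> a x y; apply: val_inj; rewrite /= scalerDr. Qed.
Fact hc_scaleDl x : {morph hc_scale^~ x : a b / a + b}.
Proof. by move=> a b; apply: val_inj; rewrite /= scalerDl. Qed.

HB.instance Definition _ := GRing.Zmodule_isLmodule.Build (F0 F) homogComp
  hc_scaleA hc_scale1 hc_scaleDr hc_scaleDl.

End HomogeneousComponent.

Definition mask_pair (V W : zmodType) (s t : seq G) (f : G -> V) (h : G -> W)
    (g : G) : V * W :=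
  (if g \in s then f g else 0, if g \in t then h g else 0).

Lemma sum_pair (V W : zmodType) (s t : seq G) (f : G -> V) (h : G -> W) :
  uniq s -> uniq t ->
  (\sum_(g <- s) f g, \sum_(g <- t) h g) =
  \sum_(g <- undup (s ++ t)) mask_pair s t f h g.
Proof.
move=> us ut; rewrite [RHS]surjective_pairing !raddf_sum /=.
congr (_, _); apply: sum_mask => //; try exact: undup_uniq;
  by move=> g gs; rewrite mem_undup mem_cat gs ?orbT.
Qed.

Definition gs_sum_comp (V W : gradedSpace) (g : G) : {pred V * W} :=
  predX (gs_comp V g) (gs_comp W g).

Fact gs_sum_grading (V W : gradedSpace) : is_grading (@gs_sum_comp V W).
Proof.
have [Vz Vs Vi] := gs_grading V; have [Wz Ws Wi] := gs_grading W.
split.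
- move=> g; have [V0 VB] := Vz g; have [W0 WB] := Wz g.
  split; first by rewrite !inE /= V0 W0.
  move=> x y; rewrite !inE => /andP[xV xW] /andP[yV yW].
  by rewrite VB ?WB.
- move=> [x y]; have [s [f [us fC ->]]] := Vs x.
  have [t [h [ut hC ->]]] := Ws y.
  exists (undup (s ++ t)), (mask_pair s t f h).
  split; [exact: undup_uniq| |exact: sum_pair].
  move=> g; rewrite !inE /=; apply/andP; split; case: ifP => // _.
    by case: (Vz g).
  by case: (Wz g).
- move=> s f us fC; rewrite [X in X = _]surjective_pairing !raddf_sum /=.
  move=> [f1 f2] g gs; rewrite [f g]surjective_pairing.
  have -> : (f g).1 = 0.
    apply: (Vi s (fun g => (f g).1)) => // g'.
    by have := fC g'; rewrite !inE => /andP[].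
  have -> // : (f g).2 = 0.
  apply: (Wi s (fun g => (f g).2)) => // g'.
  by have := fC g'; rewrite !inE => /andP[].
Qed.

Fact gs_sum_scale (V W : gradedSpace) g h (a : F) (x : V * W) :
  a \in gf_comp F g -> x \in @gs_sum_comp V W h ->
  a *: x \in @gs_sum_comp V W (g + h).
Proof. by move=> ag; rewrite !inE => /andP[? ?]; rewrite !gs_scale. Qed.

Definition gs_sum (V W : gradedSpace) : gradedSpace :=
  GradedSpace (gs_sum_grading V W) (@gs_sum_scale V W).

Fact gs_zero_grading : is_grading (fun _ => xpredT : {pred 'rV[F]_0}).
Proof.
split=> // [x|s f _ _ _ g _]; last exact: thinmx0.
by exists [::], (fun=> 0); rewrite big_nil; split=> //; exact: thinmx0.
Qed.

Definition gs_zero : gradedSpace :=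
  @GradedSpace 'rV[F]_0 _ gs_zero_grading (fun _ _ _ _ _ _ => isT).

Lemma is_graded_subspaceX (V W : gradedSpace) (A : {pred V}) (B : {pred W}) :
  submod_closed A -> submod_closed B ->
  is_graded_subspace A -> is_graded_subspace B ->
  @is_graded_subspace (gs_sum V W) (predX A B).
Proof.
move=> [A0 _] [B0 _] gA gB [x y]; rewrite !inE /= => /andP[xA yB].
have [s [f [us fC fA ->]]] := gA _ xA; have [t [h [ut hC hB ->]]] := gB _ yB.
have [Vz _ _] := gs_grading V; have [Wz _ _] := gs_grading W.
exists (undup (s ++ t)), (mask_pair s t f h).
split; [exact: undup_uniq| | |exact: sum_pair].
  move=> g; rewrite !inE /=; apply/andP; split; case: ifP => // _.
    by case: (Vz g).
  by case: (Wz g).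
by move=> g; rewrite !inE /=; apply/andP; split; case: ifP => // _.
Qed.

Record gradedQuadSpace := GradedQuadSpace {
  gq_space :> gradedSpace;
  gq_form : gq_space -> F;
  gq_quadratic : is_quadratic_form gq_form;
  gq_degree : forall g x, x \in gs_comp gq_space g ->
    gq_form x \in gf_comp F (g *+ 2);
  gq_polar_degree : forall g h x y,
    x \in gs_comp gq_space g -> y \in gs_comp gq_space h ->
    polar gq_form x y \in gf_comp F (g + h)
}.

Fact gf_comp0 g : 0 \in gf_comp F g.
Proof. by case: (gf_grading F) => /(_ g) []. Qed.

Fact gf_compD g x y :
  x \in gf_comp F g -> y \in gf_comp F g -> x + y \in gf_comp F g.
Proof.
have [Cz _ _] := gf_grading F; have [C0 CB] := Cz g => xg yg.
by rewrite -[y]opprK CB // -[- y]sub0r CB.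
Qed.

Program Definition gq_zero : gradedQuadSpace := @GradedQuadSpace gs_zero
  (fun=> 0) (@zero_quadratic F 'rV_0) (fun g _ _ => gf_comp0 _) _.
Next Obligation. by move=> *; rewrite /polar !subr0 gf_comp0. Qed.

Fact gq_sum_degree (q r : gradedQuadSpace) g x :
  x \in gs_comp (gs_sum q r) g ->
  orth_sum (@gq_form q) (@gq_form r) x \in gf_comp F (g *+ 2).
Proof. by rewrite !inE => /andP[? ?]; rewrite gf_compD ?gq_degree. Qed.

Fact gq_sum_polar_degree (q r : gradedQuadSpace) g h x y :
  x \in gs_comp (gs_sum q r) g -> y \in gs_comp (gs_sum q r) h ->
  polar (orth_sum (@gq_form q) (@gq_form r)) x y \in gf_comp F (g + h).
Proof.
rewrite !inE polar_orth_sum => /andP[? ?] /andP[? ?].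
by rewrite gf_compD ?gq_polar_degree.
Qed.

Definition gq_sum (q r : gradedQuadSpace) : gradedQuadSpace :=
  @GradedQuadSpace (gs_sum q r) _
    (orth_sum_quadratic (gq_quadratic q) (gq_quadratic r))
    (@gq_sum_degree q r) (@gq_sum_polar_degree q r).

Definition gq_isometric (q r : gradedQuadSpace) : Prop :=
  exists f : q -> r,
    is_isometry (@gq_form q) (@gq_form r) f /\ is_graded_map f.

Definition gq_hyperbolic (q : gradedQuadSpace) : Prop :=
  nonsingular (@gq_form q) /\
  exists U W : {pred q},
    [/\ is_direct_decomposition U W, is_graded_subspace U,
        is_graded_subspace W, vanishes_on (@gq_form q) U
      & vanishes_on (@gq_form q) W].

Variable even : bool.

Definition gq_adm (q : gradedQuadSpace) : Prop := admissible even (@gq_form q).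

Definition gnsForm := {q : gradedQuadSpace | gq_adm q}.

Definition gnsForm_zero : gnsForm := exist _ gq_zero (@admissible_triv F even).

Definition gnsForm_sum (q r : gnsForm) : gnsForm :=
  exist _ (gq_sum (sval q) (sval r))
    (admissible_orth_sum (gq_quadratic (sval q)) (gq_quadratic (sval r))
       (svalP q) (svalP r)).

Definition gnsForm_isometric (q r : gnsForm) := gq_isometric (sval q) (sval r).
Definition gnsForm_hyperbolic (q : gnsForm) := gq_hyperbolic (sval q).

Fact gnsForm_isom_refl q : gnsForm_isometric q q.
Proof. by exists id; split=> //; exact: isometry_id. Qed.

Fact gnsForm_isom_sym q r : gnsForm_isometric q r -> gnsForm_isometric r q.
Proof.
move=> [f [fP fG]]; have [_ [g fK gK] _] := fP.
exists g; split; first exact: isometry_inv fP.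
by move=> d x; rewrite -fG gK.
Qed.

Fact gnsForm_isom_trans q r s :
  gnsForm_isometric q r -> gnsForm_isometric r s -> gnsForm_isometric q s.
Proof.
move=> [f [fP fG]] [g [gP gG]]; exists (g \o f).
by split; [exact: isometry_comp gP | move=> d x; rewrite /= gG fG].
Qed.

Fact gnsForm_isom_sum q q' r r' :
  gnsForm_isometric q q' -> gnsForm_isometric r r' ->
  gnsForm_isometric (gnsForm_sum q r) (gnsForm_sum q' r').
Proof.
move=> [f [fP fG]] [g [gP gG]]; exists (fun x => (f x.1, g x.2)).
by split; [exact: isometry_sum | move=> d x; rewrite !inE /= fG gG].
Qed.

Fact gnsForm_sumA q r s : gnsForm_isometric
  (gnsForm_sum q (gnsForm_sum r s)) (gnsForm_sum (gnsForm_sum q r) s).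
Proof.
exists (fun x => ((x.1, x.2.1), x.2.2)); split; first exact: isometry_sumA.
by move=> d x; rewrite !inE /= andbA.
Qed.

Fact gnsForm_sumC q r : gnsForm_isometric (gnsForm_sum q r) (gnsForm_sum r q).
Proof.
exists (fun x => (x.2, x.1)); split; first exact: isometry_sumC.
by move=> d x; rewrite !inE /= andbC.
Qed.

Fact gnsForm_sum0 q : gnsForm_isometric (gnsForm_sum gnsForm_zero q) q.
Proof. by exists snd; split=> //; exact: isometry_sum0. Qed.

Fact gnsForm_hyperbolic0 : gnsForm_hyperbolic gnsForm_zero.
Proof.
split; first by case: (admissible_triv F even).
have gT : @is_graded_subspace gs_zero xpredT.
  move=> x _; exists [::], (fun=> 0); split=> //.
  by rewrite big_nil; exact: thinmx0.
exists xpredT, xpredT; split=> //; exact: direct_decomposition_triv.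
Qed.

Fact gnsForm_hyperbolicD q r :
  gnsForm_hyperbolic q -> gnsForm_hyperbolic r ->
  gnsForm_hyperbolic (gnsForm_sum q r).
Proof.
move=> [nq [U [W [qUW gU gW qU qW]]]] [nr [U' [W' [rUW gU' gW' rU rW]]]].
split; first by apply: orth_sum_nonsingular => //; exact: gq_quadratic.
exists (predX U U'), (predX W W'); split; try exact: vanishes_onX.
- exact: direct_decompositionX.
- by apply: is_graded_subspaceX => //; [case: qUW | case: rUW].
- by apply: is_graded_subspaceX => //; [case: qUW | case: rUW].
Qed.

Definition gnsForm_system : formSystem :=
  FormSystem gnsForm_isom_refl gnsForm_isom_sym gnsForm_isom_trans
    gnsForm_isom_sum gnsForm_sumA gnsForm_sumC gnsForm_sum0
    gnsForm_hyperbolic0 gnsForm_hyperbolicD.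

End GradedSpaces.

Section ResidueForms.
Variable F : gradedField.

(* The subgroup 2 Gamma_F; gradeCoset below is Gamma_F / 2 Gamma_F.           *)
Definition double_grade_set : set G :=
  [set g *+ 2 | g in grade_set F]%classic.

Definition gradeCoset :=
  {D : set G | exists2 g, grade_set F g &
     D = [set g + h | h in double_grade_set]%classic}.

(* The choice of delta in each coset Delta and of pi_delta in F_delta.        *)
Record cosetChoice := CosetChoice {
  cc_delta : gradeCoset -> G;
  cc_pi : gradeCoset -> F;
  cc_delta_in : forall D, sval D (cc_delta D);
  cc_pi_in : forall D, cc_pi D \in gf_comp F (cc_delta D);
  cc_pi_neq0 : forall D, cc_pi D != 0;
  cc_trivial : forall D, sval D = double_grade_set ->
    cc_delta D = 0 /\ cc_pi D = 1
}.

(* The form q_Delta on V_{delta/2}.                                           *)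
Variables (c : cosetChoice) (q : gradedQuadSpace F) (D : gradeCoset).

Definition residue_space : lmodType (F0 F) :=
  homogComp q (half (cc_delta c D)).

Fact residue_form_subproof (x : residue_space) :
  (cc_pi c D)^-1 * gq_form (val x) \in gf_comp F 0.
Proof.
have := gf_mul (gf_inv (cc_pi_in c D) (cc_pi_neq0 c D)) (gq_degree (valP x)).
by rewrite halfK addNr.
Qed.

Definition residue_form (x : residue_space) : F0 F :=
  Degree0 (residue_form_subproof x).

Fact residue_quadratic : is_quadratic_form residue_form.
Proof.
have [qZ qB] := gq_quadratic q.
have valB x y : val (polar residue_form x y) =
    (cc_pi c D)^-1 * polar (@gq_form _ q) (val x) (val y).
  by rewrite /polar /= !mulrBr.
apply: is_quadratic_formP => [a x|y a x z]; apply: val_inj.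
  by rewrite !expr2 /= qZ expr2 !mulrA.
rewrite valB -[val (a *: x + z)]/(val a *: val x + val z) (qB (val y)).1 /=.
rewrite -[RHS]/(val a * val (polar residue_form y x)
  + val (polar residue_form y z)) !valB.
by rewrite mulrDr mulrCA.
Qed.

Definition residue : quadSpace (F0 F) := QuadSpace residue_quadratic.

End ResidueForms.

Section ResidueIsomorphism.
Variables (even : bool) (F : gradedField) (c : cosetChoice F).

Definition graded_witt_group : comMonoid :=
  witt_group (gnsForm_system F even).

Definition residue_witt_group : comMonoid :=
  direct_sum (gradeCoset F) (witt_group (nsForm_system (F0 F) even)).

(* The existence of adm says that all the q_Delta are nonsingular forms of    *)
(* finite (even, if required) dimension, so that they have Witt classes.      *)
Definition is_residue_isomorphism
    (phi : graded_witt_group -> residue_witt_group) : Prop :=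
  is_group_isomorphism phi /\
  exists adm : forall (q : gnsForm F even) (D : gradeCoset F),
      qs_adm even (residue c (sval q) D),
    forall (q : gnsForm F even) (D : gradeCoset F),
      dsum_coord (phi (@witt_class (gnsForm_system F even) q)) D =
      @witt_class (nsForm_system (F0 F) even) (exist _ _ (adm q D)).

End ResidueIsomorphism.

End Graded.

(* Main.v *)
(* The polar form pairs the component V_g nontrivially only with components
   V_h such that g + h lies in Gamma_F.  Hence the components of q of degrees in
   delta/2 + Gamma_F, which q_Delta determines, are orthogonal to all others,
   while the cosets g + Gamma_F and - g + Gamma_F with 2g outside Gamma_F pair
   off into totally singular subspaces.  Choosing one coset out of each such
   pair, Lagrangians of the residues extend to Lagrangians of q: a form all of
   whose residues are hyperbolic is hyperbolic.  Conversely a form over F_0,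
   scaled by pi_delta and extended to F, has that form as its only nonzero
   residue.  Adding such lifts of hyperbolic forms shows that the kernel is
   trivial, without Witt cancellation, and lifting gives surjectivity.

   Over Q[t, t^-1], replacing pi = t by - t on the coset of odd degrees changes
   the residue x^2 into - x^2, which is a different Witt class because
   x^2 + y^2 is anisotropic over Q. *)

Require Import Defs.
From HB Require Import structures.
From mathcomp Require Import all_boot all_order all_algebra.
From mathcomp Require Import ring zify.
From mathcomp Require Import boolp classical_sets cardinality.

Set Implicit Arguments.
Unset Strict Implicit.
Unset Printing Implicit Defensive.

Import GRing.Theory.

Local Open Scope ring_scope.

(** * Quadratic forms over rings and fields *)

(** Two obstacles shape the proof. The first is parity: if 2 is invertible and Gamma_F differs from
    2 Gamma_F, an even-dimensional form can have odd-dimensional residues. The isomorphism is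
    therefore proved once for either value of the flag [even], assuming that residues of admissible
    forms are admissible. For [true] this is supplied under the hypothesis that 2 = 0 or Gamma_F = 2
    Gamma_F; both cases rest on the fact that an invertible alternating matrix has even size. The
    second is characteristic 2: forms are coded by matrices that need not be symmetric, and the
    diagonal in q _|_ -q needs a complement other than the antidiagonal, which coincides with it
    there. Moreover F is not a field, so linear algebra over F goes through homogeneous bases, where
    a nonzero homogeneous coefficient is a unit. *)

Section PolarCalculus.
Variables (R : comNzRingType) (V : lmodType R) (q : V -> R).
Hypothesis Qq : is_quadratic_form q.

Lemma quadraticD x y : q (x + y) = q x + q y + polar q x y.
Proof. by rewrite /polar; ring. Qed.

Lemma polarDZr a x y z :
  polar q x (a *: y + z) = a * polar q x y + polar q x z.
Proof. exact: (Qq.2 x).1. Qed.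

Lemma polar0r x : polar q x 0 = 0.
Proof. by rewrite /polar addr0 quadratic0 // subrr subr0. Qed.

Lemma polarDr x y z : polar q x (y + z) = polar q x y + polar q x z.
Proof. by rewrite -{1}[y]scale1r polarDZr mul1r. Qed.

Lemma polarZr a x y : polar q x (a *: y) = a * polar q x y.
Proof. by rewrite -[a *: y]addr0 polarDZr polar0r addr0. Qed.

Lemma polarNr x y : polar q x (- y) = - polar q x y.
Proof. by rewrite -scaleN1r polarZr mulN1r. Qed.

Lemma polar_sumr (I : Type) (s : seq I) (P : pred I) x (f : I -> V) :
  polar q x (\sum_(i <- s | P i) f i) = \sum_(i <- s | P i) polar q x (f i).
Proof.
exact: (big_morph (polar q x) (polarDr x) (polar0r x)).
Qed.

Lemma polarDl x y z : polar q (x + y) z = polar q x z + polar q y z.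
Proof. by rewrite !(polarC _ _ z) polarDr. Qed.

Lemma polarZl a x y : polar q (a *: x) y = a * polar q x y.
Proof. by rewrite !(polarC _ _ y) polarZr. Qed.

Lemma polar_suml (I : Type) (s : seq I) (P : pred I) x (f : I -> V) :
  polar q (\sum_(i <- s | P i) f i) x = \sum_(i <- s | P i) polar q (f i) x.
Proof. by rewrite polarC polar_sumr; apply: eq_bigr => i _; rewrite polarC. Qed.

Lemma polar_diag x : polar q x x = q x *+ 2.
Proof.
rewrite /polar -[x in x + x]scale1r -scalerDl Qq.1; ring.
Qed.

Lemma quadraticN x : q (- x) = q x.
Proof. by rewrite -scaleN1r Qq.1 sqrrN expr1n mulr1. Qed.

Lemma quadratic_sum_eq0 (I : eqType) (s : seq I) (f : I -> V) :
  (forall i, i \in s -> q (f i) = 0) ->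
  (forall i j, i \in s -> j \in s -> polar q (f i) (f j) = 0) ->
  q (\sum_(i <- s) f i) = 0.
Proof.
elim: s => [|i s IHs] q0 b0; first by rewrite big_nil quadratic0.
rewrite big_cons quadraticD q0 ?mem_head // IHs; first 1 last.
- by move=> j js; rewrite q0 // inE js orbT.
- by move=> j k js ks; rewrite b0 // inE ?js ?ks orbT.
rewrite polar_sumr big1_seq ?addr0 // => j /= js.
by rewrite b0 // ?mem_head // inE js orbT.
Qed.

Lemma opp_quadratic : is_quadratic_form (fun x => - q x).
Proof.
apply: is_quadratic_formP => [a x|y a x z]; first by rewrite Qq.1 mulNr.
have pN u v : polar (fun x => - q x) u v = - polar q u v.
  by rewrite /polar !opprD.
by rewrite !pN polarDZr opprD mulrN.
Qed.

End PolarCalculus.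

Lemma polar_opp (R : comNzRingType) (V : lmodType R) (q : V -> R) x y :
  polar (fun x => - q x) x y = - polar q x y.
Proof. by rewrite /polar !opprD. Qed.

Section Isometries.
Variable R : comNzRingType.
Implicit Types V W : lmodType R.

Lemma linear_inverse V W (f : V -> W) g :
  linear f -> cancel f g -> cancel g f -> linear g.
Proof. by move=> fl fK gK a x y; apply: (can_inj fK); rewrite fl !gK. Qed.

Lemma linear_map0 V W (f : V -> W) : linear f -> f 0 = 0.
Proof.
by move=> fl; rewrite -[0 in LHS](addNr 0) -scaleN1r fl scaleN1r addNr.
Qed.

Lemma linear_mapD V W (f : V -> W) : linear f -> {morph f : x y / x + y}.
Proof. by move=> fl x y; rewrite -[x in LHS]scale1r fl scale1r. Qed.

Lemma linear_mapZ V W (f : V -> W) : linear f -> scalable f.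
Proof.
by move=> fl a x; rewrite -[a *: x]addr0 fl linear_map0 // addr0.
Qed.

Lemma linear_map_sum V W (f : V -> W) (I : Type) (s : seq I) (P : pred I)
    (h : I -> V) : linear f ->
  f (\sum_(i <- s | P i) h i) = \sum_(i <- s | P i) f (h i).
Proof.
by move=> fl; apply: big_morph; [exact: linear_mapD | exact: linear_map0].
Qed.

Lemma isometry_polar V W (q : V -> R) (r : W -> R) f x y :
  is_isometry q r f -> polar r (f x) (f y) = polar q x y.
Proof. by move=> [fl _ fq]; rewrite /polar -linear_mapD // !fq. Qed.

Lemma isometry_nonsingular V W (q : V -> R) (r : W -> R) f :
  is_isometry q r f -> nonsingular q -> nonsingular r.
Proof.
move=> fP nq x x0; have [fl [g fK gK] _] := fP.
rewrite -[x]gK (nq (g x)) ?linear_map0 // => y.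
by rewrite -(isometry_polar _ _ fP) gK.
Qed.

Lemma is_basisP V n (e : 'I_n -> V) :
  (forall x, exists c : 'I_n -> R, x = \sum_i c i *: e i) ->
  (forall c : 'I_n -> R, \sum_i c i *: e i = 0 -> forall i, c i = 0) ->
  is_basis e.
Proof.
move=> span free x; have [c xE] := span x.
exists [ffun i => c i]; split=> [|d xd].
  by rewrite xE; apply: eq_bigr => i _; rewrite ffunE.
apply/ffunP => i; rewrite ffunE; apply/eqP; rewrite -subr_eq0; apply/eqP.
apply: (free (fun i => c i - d i)).
under eq_bigr do rewrite scalerBl.
by rewrite sumrB -xE -xd subrr.
Qed.

Lemma is_basis_span V n (e : 'I_n -> V) x :
  is_basis e -> exists c : 'I_n -> R, x = \sum_i c i *: e i.
Proof. by move=> /(_ x) [c [xE _]]; exists c. Qed.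

Lemma is_basis_free V n (e : 'I_n -> V) (c : 'I_n -> R) :
  is_basis e -> \sum_i c i *: e i = 0 -> forall i, c i = 0.
Proof.
move=> /(_ 0) [d [_ dU]] c0 i.
have dc : d = [ffun i => c i].
  by apply: dU; rewrite -[LHS]c0; apply: eq_bigr => j _; rewrite ffunE.
have d0 : d = [ffun=> 0].
  by apply: dU; rewrite big1 // => j _; rewrite ffunE scale0r.
have /ffunP/(_ i) : [ffun i => c i] = [ffun=> 0] := etrans (esym dc) d0.
by rewrite !ffunE.
Qed.

(** Basis vectors indexed by a subset of ['I_n]: this is how the dimension of a homogeneous
    component becomes a count of basis vectors of suitable degree. *)
Lemma has_dim_set V n (S : {set 'I_n}) (e : 'I_n -> V) :
  (forall x, exists c : 'I_n -> R, x = \sum_(i in S) c i *: e i) ->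
  (forall c : 'I_n -> R, \sum_(i in S) c i *: e i = 0 ->
    forall i, i \in S -> c i = 0) ->
  has_dim V #|S|.
Proof.
move=> span free; exists (fun j => e (enum_val j)); apply: is_basisP => [x|c].
  have [c ->] := span x; exists (fun j => c (enum_val j)).
  by rewrite big_enum_val.
move=> c0 j.
pose c' i := oapp c 0 [pick j | enum_val j == i].
have c'E j' : c' (enum_val j') = c j'.
  rewrite /c'; case: pickP => [k /eqP /enum_val_inj -> //|/(_ j')].
  by rewrite eqxx.
rewrite -c'E; apply: free; last exact: enum_valP.
rewrite big_enum_val -[RHS]c0; apply: eq_bigr => k _.
by rewrite c'E.
Qed.

Lemma has_dim_rV n : has_dim 'rV[R]_n n.
Proof.
exists (fun i => delta_mx 0 i); apply: is_basisP => [x|c /rowP c0 i].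
  by exists (x 0); exact: row_sum_delta.
have := c0 i; rewrite mxE summxE (bigD1 i) //= big1 ?addr0 => [|j ji].
  by rewrite !mxE !eqxx mulr1.
by rewrite !mxE (eq_sym i) (negPf ji) andbF mulr0.
Qed.

(** The two change-of-basis matrices multiply to the identity, which bounds their sizes over any
    nonzero commutative ring; F itself is not a field. *)
Lemma has_dim_uniq V m n : has_dim V m -> has_dim V n -> m = n.
Proof.
suff dim_le k l : has_dim V k -> has_dim V l -> (k <= l)%N.
  by move=> Vm Vn; apply/eqP; rewrite eqn_leq !dim_le.
move=> [e eP] [f fP].
pose A := \matrix_(i, j) sval (cid (is_basis_span (e i) fP)) j.
pose B := \matrix_(i, j) sval (cid (is_basis_span (f i) eP)) j.
have AE i : e i = \sum_j A i j *: f j.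
  rewrite [LHS](svalP (cid (is_basis_span (e i) fP))).
  by apply: eq_bigr => j _; rewrite mxE.
have BE i : f i = \sum_j B i j *: e j.
  rewrite [LHS](svalP (cid (is_basis_span (f i) eP))).
  by apply: eq_bigr => j _; rewrite mxE.
apply: (@mulmx1_min R _ _ A B); apply/matrixP => i j.
apply/eqP; rewrite -subr_eq0; apply/eqP.
apply: (is_basis_free (c := fun j => (A *m B) i j - 1%:M i j) eP) => /=.
under eq_bigr do rewrite scalerBl.
rewrite sumrB; apply/eqP; rewrite subr_eq0; apply/eqP.
transitivity (e i).
  rewrite [RHS]AE; under [RHS]eq_bigr do rewrite BE scaler_sumr.
  rewrite exchange_big; apply: eq_bigr => l' _.
  by rewrite mxE scaler_suml; apply: eq_bigr => m' _; rewrite scalerA.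
rewrite (bigD1 i) //= big1 ?addr0 => [|l' li]; first by rewrite mxE eqxx scale1r.
by rewrite mxE eq_sym (negPf li) scale0r.
Qed.

End Isometries.

(** * Quadratic forms given by matrices *)

Section MatrixForms.
Variable R : comNzRingType.

(** [M] is not assumed symmetric, so that every form is covered in characteristic 2 as well; the
    Gram matrix of the polar form is [M + M^T]. *)
Definition mx_form n (M : 'M[R]_n) (x : 'rV[R]_n) : R := (x *m M *m x^T) 0 0.

Lemma polar_mx_form n (M : 'M[R]_n) x y :
  polar (mx_form M) x y = (x *m (M + M^T) *m y^T) 0 0.
Proof.
rewrite /polar /mx_form.
have -> : x *m (M + M^T) *m y^T = x *m M *m y^T + (y *m M *m x^T)^T.
  by rewrite mulmxDr mulmxDl !trmx_mul trmxK mulmxA.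
rewrite linearD /= !mulmxDl !mulmxDr !mxE.
ring.
Qed.

Lemma mx_form_quadratic n (M : 'M[R]_n) : is_quadratic_form (mx_form M).
Proof.
apply: is_quadratic_formP => [a x|y a x z].
  rewrite /mx_form linearZ /= -!scalemxAl -scalemxAr !mxE; ring.
by rewrite !polar_mx_form [(a *: x + z)^T]linearP mulmxDr -scalemxAr !mxE.
Qed.

Lemma quadratic_form_mx (V : lmodType R) (q : V -> R) n (e : 'I_n -> V) :
  is_quadratic_form q ->
  exists M : 'M[R]_n, forall c : 'rV[R]_n, q (\sum_i c 0 i *: e i) = mx_form M c.
Proof.
move=> Qq.
have [M ME] : exists M : 'I_n -> 'I_n -> R, forall c : 'I_n -> R,
    q (\sum_i c i *: e i) = \sum_i \sum_j c i * M i j * c j.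
  elim: n e => [|n IHn] e.
    by exists (fun _ _ => 0) => c; rewrite !big_ord0 quadratic0.
  have [M ME] := IHn (fun i => e (lift ord0 i)).
  (* The matrix is upper triangular, with values of q on the diagonal and polar values above it, so
     nothing is divided by 2. *)
  exists (fun i j => match unlift ord0 i, unlift ord0 j with
    | None, None => q (e ord0)
    | None, Some j' => polar q (e ord0) (e (lift ord0 j'))
    | Some _, None => 0
    | Some i', Some j' => M i' j' end) => c.
  rewrite big_ord_recl /= quadraticD ME Qq.1 big_ord_recl.
  rewrite big_ord_recl unlift_none /=.
  rewrite polar_sumr //.
  have -> : \sum_i polar q (c ord0 *: e ord0)
        (c (lift ord0 i) *: e (lift ord0 i)) =
      \sum_i c ord0 * polar q (e ord0) (e (lift ord0 i)) * c (lift ord0 i).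
    by apply: eq_bigr => i _; rewrite polarZl // polarZr //; ring.
  under [X in _ = (_ + X) + _]eq_bigr do rewrite liftK.
  rewrite expr2 mulrA (mulrC (q _)) addrAC; congr (_ + _); apply: eq_bigr => i _.
  rewrite big_ord_recl liftK unlift_none mulr0 mul0r add0r.
  by apply: eq_bigr => j _; rewrite liftK.
exists (\matrix_(i, j) M i j) => c; rewrite ME /mx_form mxE exchange_big.
apply: eq_bigr => j _ /=; rewrite !mxE mulr_suml.
by apply: eq_bigr => i _; rewrite !mxE.
Qed.

Lemma isometry_mx_form (V : lmodType R) (q : V -> R) n :
  is_quadratic_form q -> has_dim V n ->
  exists (M : 'M[R]_n) (f : 'rV[R]_n -> V), is_isometry (mx_form M) q f.
Proof.
move=> Qq [e eP]; have [M ME] := quadratic_form_mx e Qq.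
exists M, (fun c => \sum_i c 0 i *: e i); split=> //.
  move=> a x y; rewrite scaler_sumr -big_split; apply: eq_bigr => i _ /=.
  by rewrite !mxE scalerDl scalerA.
pose g x : 'rV_n := \row_i sval (cid (is_basis_span x eP)) i.
have gE x : x = \sum_i g x 0 i *: e i.
  rewrite [LHS](svalP (cid (is_basis_span x eP))).
  by apply: eq_bigr => i _; rewrite mxE.
exists g => x //=; apply/rowP => i; apply/eqP; rewrite -subr_eq0; apply/eqP.
set y := g _; apply: (is_basis_free (c := fun i => y 0 i - x 0 i) eP) => /=.
under eq_bigr do rewrite scalerBl.
by rewrite sumrB -gE subrr.
Qed.

End MatrixForms.

Lemma mx_form_nonsingular (R : comUnitRingType) n (M : 'M[R]_n) :
  M + M^T \in unitmx -> nonsingular (mx_form M).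
Proof.
move=> uB x xB0; have xB : x *m (M + M^T) = 0.
  apply/rowP => i; have := xB0 (delta_mx 0 i).
  by rewrite polar_mx_form trmx_delta -colE !mxE.
by rewrite -[x](mulmxK uB) xB mul0mx.
Qed.

Lemma mx_form_nonsingularP (k : fieldType) n (M : 'M[k]_n) :
  nonsingular (mx_form M) -> M + M^T \in unitmx.
Proof.
move=> nM; rewrite -row_free_unit; apply: inj_row_free => v vB.
by apply: nM => y; rewrite polar_mx_form vB mul0mx mxE.
Qed.

Lemma nonsingular_opp (R : comNzRingType) (V : lmodType R) (q : V -> R) :
  nonsingular q -> nonsingular (fun x => - q x).
Proof.
move=> nq x x0; apply: nq => y; apply: oppr_inj.
by rewrite -polar_opp x0 oppr0.
Qed.

(** * Hyperbolic forms over a field, alternating matrices *)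

Section FormsOverFields.
Variable k : fieldType.

Definition qs_opp (q : quadSpace k) : quadSpace k :=
  QuadSpace (opp_quadratic (qs_quadratic q)).

Lemma qs_hyperbolic_isometric (q r : quadSpace k) :
  qs_isometric q r -> qs_hyperbolic q -> qs_hyperbolic r.
Proof.
move=> [f fP] [nq [U [W [[U1 W1 dUW cUW] qU qW]]]].
have [fl [g fK gK] fq] := fP; have gl := linear_inverse fl fK gK.
split; first exact: isometry_nonsingular fP nq.
pose preim_g A : {pred r} := [pred x | g x \in (A : {pred q})].
exists (preim_g U), (preim_g W); split; last first.
- by move=> x; rewrite inE /= => /qW; rewrite -fq gK.
- by move=> x; rewrite inE /= => /qU; rewrite -fq gK.
have gsub (A : {pred q}) : submod_closed A ->
    submod_closed (preim_g A).
  move=> [A0 AZ]; split; first by rewrite inE /= linear_map0.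
  by move=> a x y; rewrite !inE /= gl; exact: AZ.
split; try exact: gsub.
  move=> x; have [u [w [uU wW xE]]] := dUW (g x).
  by exists (f u), (f w); rewrite !inE /= !fK -linear_mapD // -xE gK.
move=> x; rewrite !inE /= => xU xW.
by rewrite -[x]gK (cUW (g x)) ?linear_map0.
Qed.

(* phi represents, through the polar form, a bilinear form with diagonal q,
   which in characteristic 2 cannot be symmetric. *)
Lemma ex_polar_diag even (q : quadSpace k) : qs_adm even q ->
  exists phi : q -> q,
    linear phi /\ forall x, polar (@qs_form _ q) (phi x) x = qs_form x.
Proof.
move=> [nq [n [dn _]]].
have [M [f fP]] := isometry_mx_form (qs_quadratic q) dn.
have [fl [g fK gK] fq] := fP; have gl := linear_inverse fl fK gK.
have gP := isometry_inv fK gK fP.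
have uB := mx_form_nonsingularP (isometry_nonsingular gP nq).
(* In coordinates, with B = M + M^T, the polar form pairs x M B^-1 with y to x M y^T; at y = x this
   is q. *)
exists (fun x => f (g x *m M *m invmx (M + M^T))); split=> [a x y|x].
  by rewrite gl !mulmxDl -!scalemxAl fl.
rewrite -{2}[x]gK (isometry_polar _ _ fP) polar_mx_form mulmxKV //.
by rewrite -[RHS](congr1 _ (gK x)) fq.
Qed.

(* The diagonal has the complement {(phi z + u, phi z - z + u)}, on which the
   form vanishes because q (phi z - z) = q (phi z). *)
Lemma qs_sum_opp_hyperbolic even (q : quadSpace k) : qs_adm even q ->
  qs_hyperbolic (qs_sum q (qs_opp q)).
Proof.
move=> aq; have [phi [phil phiP]] := ex_polar_diag aq; have [nq _] := aq.
have Qq := qs_quadratic q.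
split.
  apply: orth_sum_nonsingular => //; first exact: opp_quadratic.
  exact: nonsingular_opp.
pose U : {pred q * q} := [pred x | x.1 == x.2].
pose W : {pred q * q} := [pred x | x.1 == phi (x.1 - x.2)].
exists U, W; split; last first.
- move=> [x y]; rewrite inE /= /orth_sum /= => /eqP xE.
  set z := x - y in xE; have -> : y = x - z by rewrite /z opprB addrC subrK.
  by rewrite (quadraticD _ x) quadraticN // polarNr // xE phiP addrK subrr.
- by move=> [x y]; rewrite inE /= /orth_sum /= => /eqP ->; rewrite subrr.
split.
- split; first by rewrite inE /=.
  by move=> a [x y] [z t]; rewrite !inE /= => /eqP -> /eqP ->.
- split; first by rewrite inE /= subr0 linear_map0.
  move=> a [x y] [z t]; rewrite !inE /= => /eqP xE /eqP zE.
  by rewrite opprD addrACA -scalerBr phil -xE -zE.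
- move=> [x y]; pose z := x - y; exists (x - phi z, x - phi z), (phi z, phi z - z).
  split; first by rewrite inE /=.
    by rewrite inE /= opprB addrC subrK.
  congr (_, _); first by rewrite subrK.
  by rewrite addrA subrK /z opprB addrC subrK.
- move=> [x y]; rewrite !inE /= => /eqP -> /eqP.
  by rewrite subrr linear_map0 // => ->.
Qed.

Lemma ex_max_rank n (P : 'M[k]_n -> Prop) : P 0 ->
  exists2 X, P X & forall Y, P Y -> (\rank Y <= \rank X)%N.
Proof.
move=> P0; pose Q r := `[< exists2 X, P X & \rank X = r >].
have exQ : exists r, Q r by exists 0%N; apply/asboolP; exists 0; rewrite ?mxrank0.
have leQ r : Q r -> (r <= n)%N by move=> /asboolP[X _ <-]; exact: rank_leq_row.
case: (ex_maxnP exQ leQ) => r /asboolP[X PX <-] maxX; exists X => // Y PY.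
by apply: maxX; apply/asboolP; exists Y.
Qed.

(* A maximal totally isotropic subspace is its own orthogonal. *)
Lemma alternating_unitmx_even n (A : 'M[k]_n) : A \in unitmx ->
  (forall x : 'rV_n, (x *m A *m x^T) 0 0 = 0) -> ~~ odd n.
Proof.
move=> uA altA.
have rv0 (M : 'M[k]_1) : M 0 0 = 0 -> M = 0.
  by move=> M0; apply/matrixP => i j; rewrite !ord1 M0 mxE.
have skew m' p (X : 'M[k]_(m', n)) (Y : 'M[k]_(p, n)) :
    X *m A *m Y^T = - (Y *m A *m X^T)^T.
  suff AT : A^T = - A by rewrite !trmx_mul AT trmxK mulNmx mulmxN opprK mulmxA.
  apply/matrixP => i j; rewrite !mxE; apply/eqP; rewrite -addr_eq0.
  have aE (l m : 'I_n) : let d i : 'rV[k]_n := delta_mx 0 i in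
      (d l *m A *m (d m)^T) 0 0 = A l m.
    by move=> d; rewrite /d -rowE trmx_delta -colE !mxE.
  have := altA (delta_mx 0 i + delta_mx 0 j); rewrite linearD /= mulmxDl mulmxDl.
  rewrite !mulmxDr [_ 0 0]mxE [X in X + _]mxE [X in _ + X]mxE !aE.
  have ad l : A l l = 0 by rewrite -aE altA.
  by rewrite !ad add0r addr0 addrC => ->.
have [|X X0 maxX] := ex_max_rank (P := fun X => X *m A *m X^T = 0).
  by rewrite !mul0mx.
(* [K] is the orthogonal of [X]. It has dimension n - dim X because A is invertible, so K = X yields
   n = 2 dim X. *)
pose K := kermx (A *m X^T).
have rK : \rank K = (n - \rank X)%N.
  rewrite mxrank_ker -mxrank_tr trmx_mul trmxK mxrankMfree //.
  by rewrite row_free_unit unitmx_tr.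
have XK : (X <= K)%MS by apply/sub_kermxP; rewrite mulmxA.
have KX : (K <= X)%MS.
  apply/row_subP => i; apply/negPn/negP => xX; set x := row i K in xX.
  have xA : x *m A *m X^T = 0.
    by rewrite -mulmxA; apply/sub_kermxP; exact: row_sub.
  (* Adjoining to X a vector x orthogonal to it keeps the space isotropic, since x A x^T = 0; this
     contradicts maximality unless x is in X. *)
  have Y0 : col_mx X x *m A *m (col_mx X x)^T = 0.
    rewrite tr_col_mx mul_col_mx mul_col_row xA X0.
    rewrite skew xA trmx0 oppr0 (rv0 (x *m A *m x^T)) ?altA //.
    by rewrite block_mxEv !row_mx0 col_mx0.
  have /submxP[D DE] : (X + x <= col_mx X x)%MS by rewrite addsmxE.
  have := maxX (X + x)%MS.
  rewrite DE trmx_mul !mulmxA -2!(mulmxA D) Y0 mulmx0 mul0mx.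
  move=> /(_ erefl); rewrite -DE leqNgt => /negP[].
  have := mxrank_leqif_sup (addsmxSl X x).
  rewrite addsmx_sub submx_refl (negPf xX) /= => -[le neq].
  by rewrite ltn_neqAle neq le.
have := mxrankS XK; have := mxrankS KX; rewrite rK => le1 le2.
have := rank_leq_row X; lia.
Qed.

End FormsOverFields.

(** * Graded fields and graded vector spaces *)

Arguments gf_comp {G} g0 _.
Arguments gs_comp {G F} g0 _.

(** * Homogeneous components *)

Section Components.
Variables (G : dtfGroupType) (V : zmodType) (C : G -> {pred V}).
Hypothesis gr : is_grading C.

Lemma grading_decomposition x : exists sf : seq G * (G -> V),
  [/\ uniq sf.1, forall g, sf.2 g \in C g & x = \sum_(g <- sf.1) sf.2 g].
Proof. by have [_ /(_ x) [s [f sfP]] _] := gr; exists (s, f). Qed.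

Definition grading_supp x : seq G := (sval (cid (grading_decomposition x))).1.

Definition component g x : V :=
  let sf := sval (cid (grading_decomposition x)) in
  if g \in sf.1 then sf.2 g else 0.

Lemma grading0 g : 0 \in C g.
Proof. by have [/(_ g) []] := gr. Qed.

Lemma gradingB g x y : x \in C g -> y \in C g -> x - y \in C g.
Proof. by have [/(_ g) [_ CB] _ _] := gr; exact: CB. Qed.

Lemma gradingN g x : x \in C g -> - x \in C g.
Proof. by move=> xg; rewrite -[- x]sub0r gradingB ?grading0. Qed.

Lemma gradingD g x y : x \in C g -> y \in C g -> x + y \in C g.
Proof. by move=> xg yg; rewrite -[y]opprK gradingB ?gradingN. Qed.

Lemma grading_sum g (I : Type) (s : seq I) (P : pred I) (f : I -> V) :
  (forall i, P i -> f i \in C g) -> \sum_(i <- s | P i) f i \in C g.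
Proof.
by move=> fC; elim/big_rec: _ => [|i x Pi xg]; rewrite ?grading0 ?gradingD ?fC.
Qed.

Lemma grading_supp_uniq x : uniq (grading_supp x).
Proof. by rewrite /grading_supp; case: cid => sf []. Qed.

Lemma component_in g x : component g x \in C g.
Proof.
rewrite /component; case: cid => sf [_ /= sfC _].
by case: ifP; rewrite ?grading0.
Qed.

Lemma component_notin_supp g x : g \notin grading_supp x -> component g x = 0.
Proof. by rewrite /component => /negPf ->. Qed.

Lemma component_sum x : x = \sum_(g <- grading_supp x) component g x.
Proof.
rewrite /component /grading_supp; case: cid => -[s f] [/= _ _ {1}->].
by apply: eq_big_seq => g ->.
Qed.

Lemma component_sum_sub s x : uniq s -> {subset grading_supp x <= s} ->
  x = \sum_(g <- s) component g x.
Proof.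
move=> us ss; rewrite {1}[x]component_sum (sum_mask _ _ us) ?grading_supp_uniq //.
by apply: eq_bigr => g _; case: ifPn => // /component_notin_supp ->.
Qed.

(** [component] is defined from a chosen decomposition; this frees it from the choice. The
    difference of two decompositions, padded by zeros to a common list of degrees, decomposes 0 into
    homogeneous terms, which must all vanish. *)
Lemma component_eq s f x g : uniq s -> (forall h, f h \in C h) ->
  x = \sum_(h <- s) f h -> component g x = if g \in s then f g else 0.
Proof.
move=> us fC xE; pose t := undup (g :: s ++ grading_supp x).
have ut : uniq t by exact: undup_uniq.
pose d h := component h x - (if h \in s then f h else 0).
have dC h : d h \in C h.
  by apply: gradingB; [exact: component_in | case: ifP; rewrite ?grading0].
have d0 : \sum_(h <- t) d h = 0.
  rewrite sumrB -component_sum_sub //; last first.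
    by move=> h hs; rewrite mem_undup inE mem_cat hs !orbT.
  rewrite -sum_mask // -?xE ?subrr // => h hs.
  by rewrite mem_undup inE mem_cat hs orbT.
apply/eqP; rewrite -subr_eq0; apply/eqP; have [_ _ indep] := gr.
by apply: (indep t d) => //; rewrite mem_undup mem_head.
Qed.

Lemma component_is_zmod_morphism g : zmod_morphism (component g).
Proof.
move=> x y; pose s := undup (g :: grading_supp x ++ grading_supp y).
rewrite (@component_eq s (fun h => component h x - component h y)).
- by rewrite mem_undup mem_head.
- exact: undup_uniq.
- by move=> h; rewrite gradingB ?component_in.
- rewrite sumrB -!component_sum_sub ?undup_uniq // => h hs;
    by rewrite mem_undup inE mem_cat hs !orbT.
Qed.
HB.instance Definition _ g := GRing.isZmodMorphism.Build V V (component g)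
  (component_is_zmod_morphism g).

Lemma component_homog g h x : x \in C h ->
  component g x = if g == h then x else 0.
Proof.
move=> xh; rewrite (@component_eq [:: h] (fun h' => if h' == h then x else 0)).
- by rewrite inE; case: eqP.
- by [].
- by move=> h'; case: eqP => [->|_] //; rewrite grading0.
- by rewrite big_seq1 eqxx.
Qed.

Lemma component_id g x : x \in C g -> component g x = x.
Proof. by move=> xg; rewrite (component_homog _ xg) eqxx. Qed.

Lemma component_eq0 x : (forall g, component g x = 0) -> x = 0.
Proof. by move=> x0; rewrite [x]component_sum big1. Qed.

End Components.

Section GradedFieldTheory.
Variables (G : dtfGroupType) (F : gradedField G).

Lemma gf_unitM g h (x y : F) : x \in gf_comp F g -> y \in gf_comp F h ->
  x != 0 -> y != 0 -> x * y != 0.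
Proof.
move=> xg yh x0; apply: contraNneq => xy0.
by rewrite -[y](mulKr (gf_unit xg x0)) xy0 mulr0.
Qed.

Lemma grade_set0 : grade_set F 0.
Proof. by exists 1; [exact: gf_one | exact: oner_neq0]. Qed.

Lemma grade_setD g h : grade_set F g -> grade_set F h -> grade_set F (g + h).
Proof.
move=> [x xg x0] [y yh y0]; exists (x * y); first exact: gf_mul.
exact: gf_unitM xg yh x0 y0.
Qed.

Lemma grade_setN g : grade_set F g -> grade_set F (- g).
Proof.
move=> [x xg x0]; exists x^-1; first exact: gf_inv.
by rewrite invr_eq0.
Qed.

Lemma grade_setB g h : grade_set F g -> grade_set F h -> grade_set F (g - h).
Proof. by move=> Fg Fh; apply: grade_setD => //; exact: grade_setN. Qed.

Lemma grade_setBC g h : grade_set F (g - h) -> grade_set F (h - g).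
Proof. by move=> /grade_setN; rewrite opprB. Qed.

Lemma grade_set_sub2r g h : grade_set F h -> grade_set F (g + h) -> grade_set F g.
Proof. by move=> Fh /grade_setB - /(_ h Fh); rewrite addrK. Qed.

Lemma grade_set_trans g h l :
  grade_set F (g - h) -> grade_set F (h - l) -> grade_set F (g - l).
Proof. by move=> gh hl; have := grade_setD gh hl; rewrite addrA subrK. Qed.

Lemma gf_comp_eq0 g (x : F) : x \in gf_comp F g -> ~ grade_set F g -> x = 0.
Proof. by move=> xg Ng; apply/eqP/negPn/negP => x0; apply: Ng; exists x. Qed.

(* Junk value 1 when F has no nonzero element of degree g. *)
Definition homog_unit g : F :=
  if pselect (grade_set F g) is left Fg then s2val (cid2 Fg) else 1.

Lemma homog_unit_in g : grade_set F g -> homog_unit g \in gf_comp F g.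
Proof. by rewrite /homog_unit; case: pselect => // Fg _; case: cid2. Qed.

Lemma homog_unit_unit g : homog_unit g \is a GRing.unit.
Proof.
rewrite /homog_unit; case: pselect => [Fg|_]; last exact: unitr1.
by case: cid2 => x xg x0 /=; exact: gf_unit xg x0.
Qed.

Lemma homog_unitV_in g : grade_set F g -> (homog_unit g)^-1 \in gf_comp F (- g).
Proof.
move=> Fg; apply: gf_inv; first exact: homog_unit_in.
by apply: contraTneq (homog_unit_unit g) => ->; rewrite unitr0.
Qed.

End GradedFieldTheory.

Section GradedSpaceTheory.
Variables (G : dtfGroupType) (F : gradedField G) (V : gradedSpace F).

Local Notation compF := (component (gf_grading F)).
Local Notation compV := (component (gs_grading V)).

Lemma component_scale g h (a : F) (x : V) : a \in gf_comp F h ->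
  compV g (a *: x) = a *: compV (g - h) x.
Proof.
move=> ah; pose f l := a *: compV (l - h) x.
rewrite (@component_eq _ _ _ (gs_grading V)
  [seq l + h | l <- grading_supp (gs_grading V) x] f).
- case: ifPn => // gs; rewrite component_notin_supp ?scaler0 //.
  by apply: contraNN gs => gs; apply/mapP; exists (g - h); rewrite ?subrK.
- by rewrite map_inj_uniq ?grading_supp_uniq //; exact: addIr.
- by move=> l; rewrite -{2}[l](subrK h) addrC gs_scale ?component_in.
- rewrite big_map -[in RHS]/(\sum_(j <- _) f (j + h)) /f.
  under eq_bigr do rewrite addrK.
  by rewrite -scaler_sumr -component_sum.
Qed.

Lemma component_scaler g h (a : F) (x : V) : x \in gs_comp V h ->
  compV g (a *: x) = compF (g - h) a *: x.
Proof.
move=> xh; pose f l := compF (l - h) a *: x.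
rewrite (@component_eq _ _ _ (gs_grading V)
  [seq l + h | l <- grading_supp (gf_grading F) a] f).
- case: ifPn => // gs; rewrite component_notin_supp ?scale0r //.
  by apply: contraNN gs => gs; apply/mapP; exists (g - h); rewrite ?subrK.
- by rewrite map_inj_uniq ?grading_supp_uniq //; exact: addIr.
- by move=> l; rewrite -{2}[l](subrK h) gs_scale ?component_in.
- rewrite big_map /f; under eq_bigr do rewrite addrK.
  by rewrite -scaler_suml -component_sum.
Qed.

Lemma graded_subspace_component (U : {pred V}) g x : 0 \in U ->
  is_graded_subspace U -> x \in U -> compV g x \in U.
Proof.
move=> U0 gU /gU[s [f [us fC fU xE]]].
by rewrite (component_eq (gs_grading V) g us fC xE); case: ifP.
Qed.

End GradedSpaceTheory.

(** * Homogeneous bases and dimensions of components *)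

Section HomogeneousBasis.
Variables (G : dtfGroupType) (F : gradedField G) (V : gradedSpace F).

Local Notation compF := (component (gf_grading F)).
Local Notation compV := (component (gs_grading V)).

Definition homog_spanning n (e : 'I_n -> V) (d : 'I_n -> G) : Prop :=
  (forall i, e i \in gs_comp V (d i)) /\
  forall x, exists c : 'I_n -> F, x = \sum_i c i *: e i.

Lemma ex_homog_spanning n : has_dim V n ->
  exists m (e : 'I_m -> V) d, homog_spanning e d.
Proof.
move=> [b bP].
pose s := flatten [seq [seq (g, compV g (b i)) |
  g <- grading_supp (gs_grading V) (b i)] | i <- enum 'I_n].
pose e (i : 'I_(size s)) := (tnth (in_tuple s) i).2.
pose d (i : 'I_(size s)) := (tnth (in_tuple s) i).1.
pose spanned x := exists c : 'I_(size s) -> F, x = \sum_i c i *: e i.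
have spanD x y : spanned x -> spanned y -> spanned (x + y).
  move=> [c ->] [c' ->]; exists (fun i => c i + c' i).
  by rewrite -big_split; apply: eq_bigr => i _; rewrite /= scalerDl.
have span0 : spanned 0.
  by exists (fun=> 0); rewrite big1 // => i _; rewrite scale0r.
have spanZ a x : spanned x -> spanned (a *: x).
  move=> [c ->]; exists (fun i => a * c i).
  by rewrite scaler_sumr; apply: eq_bigr => i _; rewrite scalerA.
have span_mem g x : (g, x) \in s -> spanned x.
  move=> /(nthP (0, 0))[i ltis iE]; pose i' := Ordinal ltis.
  exists (fun j => (j == i')%:R); rewrite (bigD1 i') //= eqxx scale1r big1.
    by rewrite addr0 /e (tnth_nth (0, 0)) /= iE.
  by move=> j /negPf ->; rewrite scale0r.
exists (size s), e, d; split=> [i|x].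
  have /flatten_mapP[j _ /mapP[g _ iE]] := mem_tnth i (in_tuple s).
  by rewrite /e /d iE component_in.
have [c ->] := is_basis_span x bP.
apply: (big_ind spanned) => // i _; apply: spanZ.
rewrite [b i](component_sum (gs_grading V)) big_seq.
apply: (big_ind spanned) => // g gs; apply: (span_mem g).
by apply/flatten_mapP; exists i; rewrite ?mem_enum //; apply/mapP; exists g.
Qed.

(** A nonzero coefficient of a relation need not be a unit. But the component of the relation in
    degree g + d j is again a relation, and its coefficient at j is the degree g component of [c j];
    choosing g where this is nonzero makes it a unit, so [e j] can be eliminated. *)
Lemma homog_spanning_drop n (e : 'I_n.+1 -> V) d (c : 'I_n.+1 -> F) j :
  homog_spanning e d -> \sum_i c i *: e i = 0 -> c j != 0 ->
  homog_spanning (fun i => e (lift j i)) (fun i => d (lift j i)).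
Proof.
move=> [ed span] c0 cj0; split=> [i|x]; first exact: ed.
have [g gj0] : exists g, compF g (c j) != 0.
  apply: contrapT => c0'; move/eqP: cj0; apply.
  apply: (component_eq0 (gr := gf_grading F)) => g.
  by apply/eqP/negPn/negP => ?; apply: c0'; exists g.
pose a i := compF (g + d j - d i) (c i).
have a0 : \sum_i a i *: e i = 0.
  transitivity (compV (g + d j) (\sum_i c i *: e i)); last by rewrite c0 raddf0.
  rewrite raddf_sum; apply: eq_bigr => i _.
  by rewrite /= (component_scaler _ _ (ed i)).
have uj : a j \is a GRing.unit.
  rewrite /a addrK; apply: gf_unit gj0; exact: component_in.
have ej : e j = \sum_i (- (a j)^-1 * a (lift j i)) *: e (lift j i).
  move/eqP: a0; rewrite (bigD1_ord j) //= addr_eq0 => /eqP a0.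
  rewrite -[e j]scale1r -(mulVr uj) -scalerA a0 scalerN scaler_sumr -sumrN.
  by apply: eq_bigr => i _; rewrite scalerA mulNr scaleNr.
have [b ->] := span x.
exists (fun i => b j * (- (a j)^-1 * a (lift j i)) + b (lift j i)).
rewrite (bigD1_ord j) //= {1}ej scaler_sumr -big_split.
by apply: eq_bigr => i _; rewrite /= scalerA scalerDl.
Qed.

(** A homogeneous spanning family of least size is free, since a relation would allow one vector to
    be dropped; uniqueness of the rank then identifies its size with n. *)
Lemma homogeneous_basis n : has_dim V n ->
  exists (e : 'I_n -> V) (d : 'I_n -> G),
    is_basis e /\ forall i, e i \in gs_comp V (d i).
Proof.
move=> dn; pose Q m := `[< exists (e : 'I_m -> V) d, homog_spanning e d >].
have exQ : exists m, Q m.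
  by have [m Qm] := ex_homog_spanning dn; exists m; apply/asboolP.
case: (ex_minnP exQ) => m /asboolP[e [d edP]] minm.
have eB : is_basis e.
  apply: is_basisP; first exact: edP.2.
  case: m e d edP minm => [|m] e d edP minm c c0 j; first by case: j.
  apply/eqP/negPn/negP => cj0; suff /minm : Q m by rewrite ltnn.
  apply/asboolP; exists (fun i => e (lift j i)), (fun i => d (lift j i)).
  exact: homog_spanning_drop edP c0 cj0.
have mn : m = n by apply: (has_dim_uniq _ dn); exists e.
by subst m; exists e, d; split=> //; exact: edP.1.
Qed.

Variables (n : nat) (e : 'I_n -> V) (d : 'I_n -> G).
Hypotheses (eB : is_basis e) (ed : forall i, e i \in gs_comp V (d i)).

(** Each basis vector with g - d i in Gamma_F is moved into degree g by a homogeneous unit, and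
    these multiples form a basis over F_0; the other basis vectors cannot contribute, as F has no
    coefficient of the required degree. *)
Lemma homogComp_has_dim g :
  has_dim (homogComp V g) #|[set i | `[< grade_set F (g - d i) >]]|.
Proof.
set S := [set i | _].
pose u i := homog_unit F (g - d i).
have uS i : grade_set F (g - d i) -> u i *: e i \in gs_comp V g.
  by move=> Fi; have := gs_scale (homog_unit_in Fi) (ed i); rewrite subrK.
pose b i : homogComp V g := insubd 0 (u i *: e i).
have bE i : grade_set F (g - d i) -> val (b i) = u i *: e i.
  by move=> Fi; rewrite /b val_insubd uS.
have val_sum (c : 'I_n -> F0 F) : val (\sum_(i in S) c i *: b i) =
    \sum_i (if `[< grade_set F (g - d i) >] then val (c i) * u i else 0) *: e i.
  rewrite raddf_sum [RHS](bigID (mem S)) /=.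
  rewrite [X in _ + X]big1 ?addr0 => [|i]; last first.
    by rewrite inE => /negPf ->; rewrite scale0r.
  apply: eq_bigr => i; rewrite inE => Fi; rewrite Fi /= bE ?scalerA //.
  exact/asboolP.
apply: (has_dim_set (e := b)) => [x|c c0 i].
  have [c xE] := is_basis_span (val x) eB.
  have aP i : grade_set F (g - d i) ->
      compF (g - d i) (c i) / u i \in gf_comp F 0.
    move=> Fi; rewrite -(subrr (g - d i)); apply: gf_mul.
      exact: component_in.
    exact: homog_unitV_in.
  exists (fun i => insubd 0 (compF (g - d i) (c i) / u i)).
  apply: val_inj; rewrite val_sum -[LHS](component_id (gs_grading V) (valP x)).
  rewrite xE raddf_sum; apply: eq_bigr => i _ /=.
  rewrite (component_scaler _ _ (ed i)); case: asboolP => Fi; last first.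
    by rewrite (gf_comp_eq0 (component_in _ _ _) Fi).
  by rewrite val_insubd aP // divrK // homog_unit_unit.
rewrite inE => Fi; apply: val_inj.
pose c' i := if `[< grade_set F (g - d i) >] then val (c i) * u i else 0.
have := is_basis_free (c := c') eB; rewrite -val_sum c0 => /(_ erefl i).
rewrite /c' Fi => cu0.
by rewrite -[val (c i)](mulrK (homog_unit_unit F (g - d i))) [X in X / _]cu0 mul0r.
Qed.

End HomogeneousBasis.

(** * Residues and lifts *)

Section Cosets.
Variables (G : dtfGroupType) (F : gradedField G).

Lemma half_mulr2n (g : G) : Defs.half (g *+ 2) = g.
Proof. by apply/esym/half_unique. Qed.

Lemma gradeCosetP (D : gradeCoset F) g h : sval D g ->
  sval D h <-> exists2 l, grade_set F l & h = g + l *+ 2.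
Proof.
case: D => A /= [g0 Fg0 ->] [_ [l Fl <-] <-]; split.
  move=> [_ [m Fm <-] <-]; exists (m - l); first exact: grade_setB.
  by rewrite mulrnBl -addrA; congr (_ + _); rewrite [RHS]addrC subrK.
move=> [m Fm ->]; exists ((l + m) *+ 2); last by rewrite mulrnDl addrA.
by exists (l + m) => //; exact: grade_setD.
Qed.

Lemma gradeCoset_grade_set (D : gradeCoset F) g : sval D g -> grade_set F g.
Proof.
case: D => A /= [g0 Fg0 ->] [_ [l Fl <-] <-].
by rewrite mulr2n; do 2?apply: grade_setD.
Qed.

Lemma gradeCoset_eq (D D' : gradeCoset F) g : sval D g -> sval D' g -> D = D'.
Proof.
move=> Dg D'g; have : sval D = sval D'.
  apply/funext => h; apply/propext.
  by rewrite (gradeCosetP h Dg) (gradeCosetP h D'g).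
by case: D D' {Dg D'g} => [A pA] [B pB] /= AB; exact: eq_exist.
Qed.

Lemma ex_gradeCoset g : grade_set F g -> exists D : gradeCoset F, sval D g.
Proof.
move=> Fg; pose A : set G := [set g + h | h in double_grade_set F]%classic.
exists (exist _ A (ex_intro2 _ _ g Fg erefl)) => /=.
exists 0; last exact: addr0.
by exists 0; [exact: grade_set0 | exact: mul0rn].
Qed.

Lemma double_grade_set0 : double_grade_set F 0.
Proof. by exists 0; [exact: grade_set0 | exact: mul0rn]. Qed.

Variable c : cosetChoice F.

Lemma cc_delta_grade_set D : grade_set F (cc_delta c D).
Proof. exact: gradeCoset_grade_set (cc_delta_in c D). Qed.

Lemma cc_pi_unit D : cc_pi c D \is a GRing.unit.
Proof. exact: gf_unit (cc_pi_in c D) (cc_pi_neq0 c D). Qed.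

(** Together with [ex_half_delta], this says that the cosets delta/2 + Gamma_F are pairwise distinct
    and exhaust the degrees g with 2g in Gamma_F: multiplication by 2 identifies them with Gamma_F /
    2 Gamma_F. *)
Lemma half_delta_inj (D D' : gradeCoset F) :
  grade_set F (Defs.half (cc_delta c D) - Defs.half (cc_delta c D')) -> D = D'.
Proof.
move=> FDD'; apply: (gradeCoset_eq (cc_delta_in c D)).
apply/(gradeCosetP _ (cc_delta_in c D')); eexists; first exact: FDD'.
by rewrite mulrnBl !Defs.halfK addrC subrK.
Qed.

Lemma ex_half_delta g : grade_set F (g *+ 2) ->
  exists D, grade_set F (Defs.half (cc_delta c D) - g).
Proof.
move=> Fg; have [D Dg] := ex_gradeCoset Fg; exists D.
have /(gradeCosetP _ Dg)[l Fl ->] := cc_delta_in c D.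
by rewrite -mulrnDl half_mulr2n addrAC subrr add0r.
Qed.

End Cosets.

Section Residues.
Variables (G : dtfGroupType) (F : gradedField G) (c : cosetChoice F).
Implicit Types (q r : gradedQuadSpace F) (D : gradeCoset F).

Lemma polar_residue_form q D (x y : residue_space c q D) :
  val (polar (@residue_form G F c q D) x y) =
    (cc_pi c D)^-1 * polar (@gq_form _ _ q) (val x) (val y).
Proof. by rewrite /polar /= !mulrBr. Qed.

Lemma polar_homog_eq0 q g (x : q) :
  (forall h, grade_set F (g + h) -> forall y, y \in gs_comp q h ->
    polar (@gq_form _ _ q) x y = 0) ->
  x \in gs_comp q g -> forall y, polar (@gq_form _ _ q) x y = 0.
Proof.
move=> x0 xg y; have Qq := gq_quadratic q.
rewrite [y](component_sum (gs_grading q)) polar_sumr // big1 // => h _.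
have yh := component_in (gs_grading q) h y.
have [Fgh|NF] := EM (grade_set F (g + h)); first exact: x0 Fgh _ yh.
exact: gf_comp_eq0 (gq_polar_degree xg yh) NF.
Qed.

(** A homogeneous vector that can pair nontrivially with V_{delta/2} has its degree in delta/2 +
    Gamma_F, because delta is in Gamma_F. A homogeneous unit moves it into V_{delta/2}, so a radical
    vector of the residue lies in the radical of q. *)
Lemma residue_nonsingular q D :
  nonsingular (@gq_form _ _ q) -> nonsingular (@residue_form G F c q D).
Proof.
move=> nq x x0; apply/val_inj/nq; have Qq := gq_quadratic q.
have Fd := cc_delta_grade_set c D; set d := cc_delta c D in Fd *.
apply: (polar_homog_eq0 (g := Defs.half d)); last exact: valP.
move=> h Fh y yh; have Fdh : grade_set F (Defs.half d - h).
  have -> : Defs.half d - h = d - (Defs.half d + h).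
    by rewrite opprD addrA -{2}(Defs.halfK d) mulr2n addrK.
  exact: grade_setB.
have uyP : homog_unit F (Defs.half d - h) *: y \in gs_comp q (Defs.half d).
  by have := gs_scale (homog_unit_in Fdh) yh; rewrite subrK.
have /(congr1 val) := x0 (HomogComp uyP); rewrite polar_residue_form polarZr //=.
have uu : (cc_pi c D)^-1 * homog_unit F (Defs.half d - h) \is a GRing.unit.
  by rewrite unitrMl ?unitrV ?cc_pi_unit ?homog_unit_unit.
by rewrite mulrA => b0; apply: (mulrI uu); rewrite b0 mulr0.
Qed.

Lemma residue_adm q D : gq_adm false q -> qs_adm false (residue c q D).
Proof.
move=> [nq [n [dn _]]]; split; first exact: residue_nonsingular.
have [e [d [eB ed]]] := homogeneous_basis dn.
by eexists; split; first exact: homogComp_has_dim eB ed _.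
Qed.

Lemma residue_isometric q r D :
  gq_isometric q r -> qs_isometric (residue c q D) (residue c r D).
Proof.
move=> [f [[fl [g fK gK] fq] fG]].
have hfP (x : residue_space c q D) :
    f (val x) \in gs_comp r (Defs.half (cc_delta c D)) by rewrite fG; exact: valP.
have hgP (x : residue_space c r D) :
    g (val x) \in gs_comp q (Defs.half (cc_delta c D)) by rewrite -fG gK; exact: valP.
exists (fun x => HomogComp (hfP x)); split.
- by move=> a x y; apply: val_inj; rewrite /= fl.
- by exists (fun x => HomogComp (hgP x)) => x; apply: val_inj; rewrite /= ?fK ?gK.
- by move=> x; apply: val_inj; rewrite /= fq.
Qed.

Lemma residue_sum q r D : qs_isometric (residue c (gq_sum q r) D)
  (qs_sum (residue c q D) (residue c r D)).
Proof.
set g := Defs.half (cc_delta c D).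
have fstP (x : residue_space c (gq_sum q r) D) : (val x).1 \in gs_comp q g.
  by have /andP[] := valP x.
have sndP (x : residue_space c (gq_sum q r) D) : (val x).2 \in gs_comp r g.
  by have /andP[] := valP x.
have pairP (x : residue c q D * residue c r D) :
    (val x.1, val x.2) \in gs_comp (gs_sum q r) g.
  by apply/andP; split; exact: valP.
exists (fun x => (HomogComp (fstP x), HomogComp (sndP x))); split.
- by move=> a x y; congr (_, _); apply: val_inj.
- exists (fun x => HomogComp (pairP x)) => [x|[x y]].
    by apply: val_inj; rewrite /= -surjective_pairing.
  by congr (_, _); apply: val_inj.
- by move=> x; apply: val_inj; rewrite /= mulrDr.
Qed.

Lemma residue_hyperbolic q D : gq_hyperbolic q -> qs_hyperbolic (residue c q D).
Proof.
move=> [nq [U [W [[[U0 UZ] [W0 WZ] dUW cUW] gU gW qU qW]]]].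
split; first exact: residue_nonsingular.
pose res (A : {pred q}) : {pred residue c q D} :=
  [pred x | val (x : residue_space c q D) \in A].
exists (res U), (res W); split.
- split.
  + by split=> [|a x y]; rewrite !inE /=; [exact: U0 | exact: UZ].
  + by split=> [|a x y]; rewrite !inE /=; [exact: W0 | exact: WZ].
  + move=> x; have [u [w [uU wW xE]]] := dUW (val (x : residue_space c q D)).
    exists (HomogComp (component_in (gs_grading q) _ u)).
    exists (HomogComp (component_in (gs_grading q) _ w)).
    split; try by rewrite !inE /=; apply: graded_subspace_component.
    apply: val_inj; rewrite -[LHS](component_id (gs_grading q) (valP x)).
    by rewrite xE raddfD.
  + by move=> x; rewrite !inE /= => xU xW; apply/val_inj/cUW.
- by move=> x; rewrite inE /= => /qU q0; apply: val_inj; rewrite /= q0 mulr0.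
- by move=> x; rewrite inE /= => /qW q0; apply: val_inj; rewrite /= q0 mulr0.
Qed.

(** A nonzero V_{delta/2} requires a homogeneous basis vector with degree in delta/2 + Gamma_F, and
    by [half_delta_inj] each basis vector serves at most one coset. *)
Lemma finite_nonzero_residues q n : has_dim q n ->
  finite_set [set D | exists x : residue_space c q D, x != 0]%classic.
Proof.
move=> dn; have [e [d [eB ed]]] := homogeneous_basis dn.
pose A i := [set D | grade_set F (Defs.half (cc_delta c D) - d i)]%classic.
apply: (@sub_finite_set _ _ (\bigcup_(i in [set: 'I_n]) A i)%classic).
  move=> D /= [x x0].
  apply: contrapT => ND; move/eqP: x0; apply; apply: val_inj.
  have [a xE] := is_basis_span (val x) eB.
  rewrite -(component_id (gs_grading q) (valP x)) xE raddf_sum big1 // => i _.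
  rewrite /= (component_scaler _ _ (ed i)).
  rewrite (gf_comp_eq0 (component_in _ _ _)) ?scale0r //.
  by move=> FD; apply: ND; exists i.
apply: bigcup_finite => [|i _]; first exact: finite_finset.
have [->|/set0P[D DA]] := eqVneq (A i) set0; first exact: finite_set0.
apply: (sub_finite_set _ (finite_set1 D)) => D' D'A /=.
apply: (half_delta_inj (c := c)); apply: grade_set_trans D'A _.
exact: grade_setBC DA.
Qed.

End Residues.

(** * Extending Lagrangians of the residues *)

Section Lagrangians.
Variables (G : dtfGroupType) (F : gradedField G).

(** One element is chosen in the union of g + Gamma_F and -g + Gamma_F, a set unchanged under g ->
    -g; [P g] records whether it lies in g + Gamma_F. When 2g is outside Gamma_F the two cosets are
    disjoint, so exactly one of [P g] and [P (- g)] holds. *)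
Lemma ex_coset_sign : exists P : pred G,
  (forall g h, grade_set F (g - h) -> P g = P h) /\
  (forall g, ~ grade_set F (g *+ 2) -> P (- g) = ~~ P g).
Proof.
pose B g := [set h | grade_set F (h - g) \/ grade_set F (h + g)]%classic.
pose rep g := xget 0 (B g).
have repP g : B g (rep g).
  rewrite /rep; case: xgetP => [h _ //|/(_ g)[]].
  by left; rewrite subrr; exact: grade_set0.
have BN g : B (- g) = B g.
  by apply/funext => h; apply/propext; rewrite /B /= opprK; tauto.
have Bsub g h : grade_set F (g - h) -> (B h `<=` B g)%classic.
  move=> Fgh l [Fl|Fl]; [left|right].
    exact: grade_set_trans Fl (grade_setBC Fgh).
  by have := grade_setD Fl Fgh; rewrite addrACA subrr addr0.
have B_eq g h : grade_set F (g - h) -> B g = B h.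
  by move=> Fgh; apply/seteqP; split; apply: Bsub => //; exact: grade_setBC.
exists (fun g => `[< grade_set F (rep g - g) >]); split=> [g h Fgh|g Ng].
  rewrite /rep (B_eq _ _ Fgh); apply: asbool_equiv_eq; split=> FB.
    exact: grade_set_trans FB Fgh.
  exact: grade_set_trans FB (grade_setBC Fgh).
rewrite /rep BN -/(rep g) opprK -asbool_neg; apply: asbool_equiv_eq.
split=> [FD FB|NB]; last by case: (repP g).
apply: Ng; have := grade_setB FD FB.
by rewrite opprB addrC addrA subrK -mulr2n.
Qed.

Variables (c : cosetChoice F) (q : gradedQuadSpace F).
Local Notation comp := (component (gs_grading q)).
Local Notation hd D := (Defs.half (cc_delta c D)).

Lemma half_delta_double D g : grade_set F (hd D - g) -> grade_set F (g *+ 2).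
Proof.
move=> FD; have -> : g *+ 2 = cc_delta c D - (hd D - g) *+ 2.
  by rewrite mulrnBl Defs.halfK opprB addrC subrK.
by rewrite mulr2n; apply: grade_setB (cc_delta_grade_set c D) (grade_setD _ _).
Qed.

Section Lift.
Variables (P : pred G) (A : forall D, {pred residue_space c q D}).
Arguments A : clear implicits.
Hypothesis Pcoset : forall g h, grade_set F (g - h) -> P g = P h.
Hypothesis Aclosed : forall D, submod_closed (A D).

(** Quantifying over all scalars [u] avoids choosing the unit that moves x into V_{delta/2} and
    makes the condition stable under homogeneous scaling. If F has no nonzero element of the degree
    required of [u], the second clause only asks that 0 be in [A D]. *)
Definition lift_cond g (x : q) : Prop :=
  (~ grade_set F (g *+ 2) -> ~~ P g -> x = 0) /\
  forall D (u : F) (y : residue_space c q D),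
    u \in gf_comp F (hd D - g) -> val y = u *: x -> y \in A D.

Definition lift_subspace : {pred q} :=
  [pred x | `[< forall g, lift_cond g (comp g x) >]].

Lemma lift_subspaceP x :
  reflect (forall g, lift_cond g (comp g x)) (x \in lift_subspace).
Proof. exact: asboolP. Qed.

Lemma lift_cond0 g : lift_cond g 0.
Proof.
split=> // D u y _; rewrite scaler0 => y0.
have -> : y = 0 by exact: val_inj.
by have [] := Aclosed D.
Qed.

Lemma lift_condD g x y : lift_cond g x -> lift_cond g y ->
  x \in gs_comp q g -> lift_cond g (x + y).
Proof.
move=> [x0 xA] [y0 yA] xg; split=> [Ng NP|D u z ug zE].
  by rewrite x0 ?y0 ?addr0.
have uxP : u *: x \in gs_comp q (hd D) by have := gs_scale ug xg; rewrite subrK.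
have xz : HomogComp uxP \in A D by exact: (xA D u _ ug).
have yz : z - HomogComp uxP \in A D.
  apply: (yA D u _ ug); rewrite raddfB /= [hc_val z]zE.
  by rewrite scalerDr addrAC subrr add0r.
have [_ AZ] := Aclosed D.
by have := AZ 1 _ _ xz yz; rewrite scale1r addrC subrK.
Qed.

Lemma lift_condZ g h (a : F) x : a \in gf_comp F h -> lift_cond (g - h) x ->
  lift_cond g (a *: x).
Proof.
move=> ah [x0 xA]; split=> [Ng NP|D u y ug yE].
  have [Fh|NF] := EM (grade_set F h); last by rewrite (gf_comp_eq0 ah NF) scale0r.
  rewrite x0 ?scaler0 //.
    by move=> F2; apply: Ng; apply: (grade_set_sub2r (h := - (h *+ 2)));
       rewrite -?mulrnBl // mulr2n; apply/grade_setN/grade_setD.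
  by rewrite (@Pcoset _ g) // addrC addKr; exact: grade_setN.
apply: (xA D (u * a)); last by rewrite yE scalerA.
by have := gf_mul ug ah; rewrite -addrA (addrC (- g)) -opprB.
Qed.

Lemma lift_subspace_homog g x : x \in gs_comp q g -> lift_cond g x ->
  x \in lift_subspace.
Proof.
move=> xg xP; apply/lift_subspaceP => h; rewrite (component_homog _ _ xg).
by case: eqP => [->|_]; [exact: xP | exact: lift_cond0].
Qed.

Lemma lift_subspace0 : 0 \in lift_subspace.
Proof. by apply/lift_subspaceP => g; rewrite raddf0; exact: lift_cond0. Qed.

Lemma lift_subspaceD x y :
  x \in lift_subspace -> y \in lift_subspace -> x + y \in lift_subspace.
Proof.
move=> /lift_subspaceP xL /lift_subspaceP yL; apply/lift_subspaceP => g.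
by rewrite raddfD; apply: lift_condD => //; exact: component_in.
Qed.

Lemma lift_subspace_submod : submod_closed lift_subspace.
Proof.
split=> [|a x y /lift_subspaceP xL yL]; first exact: lift_subspace0.
apply: lift_subspaceD => //.
rewrite [a](component_sum (gf_grading F)) scaler_suml.
apply: (big_ind (fun x => x \in lift_subspace)) => [||h _].
- exact: lift_subspace0.
- exact: lift_subspaceD.
have ah := component_in (gf_grading F) h a.
apply/lift_subspaceP => g; rewrite (component_scale _ _ ah).
exact: lift_condZ ah (xL _).
Qed.

Lemma lift_subspace_graded : is_graded_subspace lift_subspace.
Proof.
move=> x /lift_subspaceP xL.
exists (grading_supp (gs_grading q) x), (fun g => comp g x); split.
- exact: grading_supp_uniq.
- by move=> g; exact: component_in.
- by move=> g; apply: (@lift_subspace_homog g) => //; exact: component_in.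
- exact: component_sum.
Qed.

Hypothesis Psign : forall g, ~ grade_set F (g *+ 2) -> P (- g) = ~~ P g.
Hypothesis Avanish : forall D, vanishes_on (@residue_form G F c q D) (A D).

(** Only components of degrees g and h with g + h in Gamma_F can interact. If 2g is in Gamma_F, both
    degrees lie in the same delta/2 + Gamma_F and units bring both components into [A D]. Otherwise
    h is in -g + Gamma_F, and the sign condition annihilates one of the two. *)
Lemma lift_subspace_vanishes : vanishes_on (@gq_form _ _ q) lift_subspace.
Proof.
move=> x /lift_subspaceP xL; have Qq := gq_quadratic q.
have unit_in D g : grade_set F (hd D - g) ->
    homog_unit F (hd D - g) *: comp g x \in gs_comp q (hd D).
  move=> Fg; have := gs_scale (homog_unit_in Fg) (component_in (gs_grading q) g x).
  by rewrite subrK.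
have in_A D g Fg : HomogComp (@unit_in D g Fg) \in A D.
  by apply: (xL g).2 => //; exact: homog_unit_in.
have uu D g : homog_unit F (hd D - g) \is a GRing.unit by exact: homog_unit_unit.
have qg g : gq_form (comp g x) = 0.
  have [Fg|NF] := EM (grade_set F (g *+ 2)); last first.
    exact: gf_comp_eq0 (gq_degree (component_in _ g x)) NF.
  have [D FD] := ex_half_delta c Fg.
  have /(congr1 val) /= := Avanish (in_A D g FD).
  rewrite Qq.1 => q0; have uP : (cc_pi c D)^-1 \is a GRing.unit.
    by rewrite unitrV cc_pi_unit.
  apply: (mulrI uP); apply: (mulIr (unitrX 2 (uu D g))).
  by rewrite mulr0 mul0r -mulrA.
rewrite [x](component_sum (gs_grading q)); apply: quadratic_sum_eq0 => // g h _ _.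
have [Fgh|NF] := EM (grade_set F (g + h)); last first.
  by apply: gf_comp_eq0 NF; apply: gq_polar_degree; exact: component_in.
have [Fg|Ng] := EM (grade_set F (g *+ 2)).
  have [D FDg] := ex_half_delta c Fg.
  have FDh : grade_set F (hd D - h).
    apply: grade_set_trans FDg _.
    by have := grade_setB Fg Fgh; rewrite mulr2n opprD addrA addrK.
  have [_ AZ] := Aclosed D.
  have vA y : y \in A D -> residue_form y = 0 := @Avanish D y.
  (* The residue form vanishes on both vectors and on their sum, hence so does their polar value. *)
  have := AZ 1 _ _ (in_A D g FDg) (in_A D h FDh); rewrite scale1r => /vA.
  rewrite (quadraticD (@residue_form G F c q D)) !vA ?in_A // !add0r.
  move=> /(congr1 val); rewrite polar_residue_form /= polarZl // polarZr // => b0.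
  have uP : (cc_pi c D)^-1 * (homog_unit F (hd D - g) * homog_unit F (hd D - h))
      \is a GRing.unit.
    by rewrite !unitrMl ?unitrV ?cc_pi_unit ?uu.
  by apply: (mulrI uP); rewrite mulr0 -!mulrA.
have PN : P h = ~~ P g.
  by rewrite -(Psign Ng); apply: Pcoset; rewrite opprK addrC.
have [Pg|NPg] := boolP (P g); last by rewrite ((xL g).1 Ng NPg) polarC polar0r.
rewrite ((xL h).1 _ _) ?polar0r ?PN ?Pg // => Fh; apply: Ng.
have -> : g *+ 2 = (g + h) *+ 2 - h *+ 2 by rewrite mulrnDl addrK.
by apply: grade_setB Fh; rewrite mulr2n; exact: grade_setD.
Qed.

End Lift.

Lemma hyperbolic_of_residues : nonsingular (@gq_form _ _ q) ->
  (forall D, qs_hyperbolic (residue c q D)) -> gq_hyperbolic q.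
Proof.
move=> nq hq; split=> //; have [P [Pcoset Psign]] := ex_coset_sign.
(* With the opposite sign for the complement, each component of degree g with 2g outside Gamma_F
   falls entirely into one of the two Lagrangians. *)
pose NP := [pred g | ~~ P g].
have NPcoset g h : grade_set F (g - h) -> NP g = NP h by move=> /Pcoset /= ->.
have NPsign g : ~ grade_set F (g *+ 2) -> NP (- g) = ~~ NP g.
  by move=> /Psign /= ->.
pose U D := projT1 (cid (hq D).2).
pose W D := projT1 (cid (projT2 (cid (hq D).2))).
have UW D : [/\ is_direct_decomposition (U D) (W D),
    vanishes_on (@residue_form G F c q D) (U D)
  & vanishes_on (@residue_form G F c q D) (W D)].
  exact: projT2 (cid (projT2 (cid (hq D).2))).
have Usub D : submod_closed (U D) by have [[]] := UW D.
have Wsub D : submod_closed (W D) by have [[]] := UW D.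
exists (lift_subspace P U), (lift_subspace NP W); split; last 4 first.
- exact: lift_subspace_graded.
- exact: lift_subspace_graded.
- by apply: lift_subspace_vanishes => // D; have [] := UW D.
- by apply: lift_subspace_vanishes => // D; have [] := UW D.
split; try exact: lift_subspace_submod.
  move=> x; pose dec x := exists u w, [/\ u \in lift_subspace P U,
    w \in lift_subspace NP W & x = u + w].
  have decD y z : dec y -> dec z -> dec (y + z).
    move=> [u [w [uU wW ->]]] [u' [w' [u'U w'W ->]]].
    by exists (u + u'), (w + w'); rewrite !lift_subspaceD // addrACA.
  have dec0 : dec 0 by exists 0, 0; rewrite !lift_subspace0 // addr0.
  rewrite -/(dec x) [x](component_sum (gs_grading q)).
  apply: (big_ind dec) => // g _; set y := comp g x.
  have yg : y \in gs_comp q g := component_in _ g x.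
  have [Fg|Ng] := EM (grade_set F (g *+ 2)); last first.
    (* For such g no coset delta/2 + Gamma_F contains g, so the scalar [u] is 0 and the second
       clause of [lift_cond] is automatic. *)
    have cond2 D (A : forall D, {pred residue_space c q D}) (u : F)
        (z : residue_space c q D) : (forall D, submod_closed (A D)) ->
        u \in gf_comp F (hd D - g) -> val z = u *: y -> z \in A D.
      move=> Asub ug; rewrite (gf_comp_eq0 ug) ?scale0r => [|/half_delta_double//].
      move=> z0; have -> : z = 0 by exact: val_inj.
      by have [] := Asub D.
    have [Pg|NPg] := boolP (P g).
      exists y, 0; rewrite lift_subspace0 // addr0; split=> //.
      apply: (lift_subspace_homog Usub yg); split; first by rewrite Pg.
      by move=> D u z; exact: cond2.
    exists 0, y; rewrite lift_subspace0 // add0r; split=> //.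
    apply: (lift_subspace_homog Wsub yg); split.
      by rewrite /NP /= negbK (negPf NPg).
    by move=> D u z; exact: cond2.
  have [D FD] := ex_half_delta c Fg; set v := homog_unit F (hd D - g).
  have uv : v \is a GRing.unit := homog_unit_unit _ _.
  have vg := homog_unit_in FD; have vVg := homog_unitV_in FD.
  have vyP : v *: y \in gs_comp q (hd D) by have := gs_scale vg yg; rewrite subrK.
  have [[_ _ dUW _] _ _] := UW D.
  have [u [w [uU wW /(congr1 val) /= vyE]]] := dUW (HomogComp vyP).
  have back (z : residue_space c q D) : v^-1 *: val z \in gs_comp q g.
    by have := gs_scale vVg (valP z); rewrite opprB subrK.
  (* A vector of [A D] moved back to degree g satisfies the lifting condition: only D itself can
     test it, and then the two scalars combine into an element of F_0, under which [A D] is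
     stable. *)
  have backL (Q : pred G) (A : forall D, {pred residue_space c q D}) z :
      (forall D, submod_closed (A D)) -> z \in A D ->
      v^-1 *: val z \in lift_subspace Q A.
    move=> Asub zA; apply: (lift_subspace_homog Asub (back z)); split=> //.
    move=> D' u' t u'g tE; have [FD'|NF] := EM (grade_set F (hd D' - g)); last first.
      have -> : t = 0 by apply: val_inj; rewrite tE (gf_comp_eq0 u'g NF) scale0r.
      by have [] := Asub D'.
    have DD : D' = D := half_delta_inj (grade_set_trans FD' (grade_setBC FD)).
    subst D'; have aP : u' / v \in gf_comp F 0.
      by have := gf_mul u'g vVg; rewrite subrr.
    have -> : t = (Degree0 aP : F0 F) *: z by apply: val_inj; rewrite tE scalerA.
    have [A0 AZ] := Asub D; rewrite -[_ *: z]addr0; exact: AZ.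
  exists (v^-1 *: val u), (v^-1 *: val w); rewrite !backL //.
  by rewrite -scalerDr -[_ + _]vyE scalerA mulVr // scale1r.
move=> x /lift_subspaceP xU /lift_subspaceP xW.
apply: (component_eq0 (gr := gs_grading q)) => g.
have [Fg|Ng] := EM (grade_set F (g *+ 2)); last first.
  have [Pg|NPg] := boolP (P g); last exact: (xU g).1.
  by apply: (xW g).1; rewrite /NP /= ?negbK.
have [D FD] := ex_half_delta c Fg; have [[_ _ _ cUW] _ _] := UW D.
have vg := homog_unit_in FD.
have vxP : homog_unit F (hd D - g) *: comp g x \in gs_comp q (hd D).
  by have := gs_scale vg (component_in (gs_grading q) g x); rewrite subrK.
have /(congr1 val) /= v0 : HomogComp vxP = 0 :> residue_space c q D.
  by apply: cUW; [apply: (xU g).2 vg _ | apply: (xW g).2 vg _].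
by rewrite -[comp g x]scale1r -(mulVr (homog_unit_unit F (hd D - g))) -scalerA
  [_ *: comp g x]v0 scaler0.
Qed.

End Lagrangians.

(** * Lifting forms from F_0 to F *)

Section LiftedForms.
Variables (G : dtfGroupType) (F : gradedField G).

Section FreeSpace.
Variables (n : nat) (h : G).

(** The standard basis vectors are all placed in degree [h], later taken to be delta/2. *)
Definition free_comp (g : G) : {pred 'rV[F]_n} :=
  [pred x : 'rV[F]_n | [forall i, x 0 i \in gf_comp F (g - h)]].

Lemma free_compP g (x : 'rV[F]_n) :
  reflect (forall i, x 0 i \in gf_comp F (g - h)) (x \in free_comp g).
Proof. exact: forallP. Qed.

Lemma free_comp_grading : is_grading free_comp.
Proof.
have gr := gf_grading F; split.
- move=> g; split; first by apply/free_compP => i; rewrite mxE (grading0 gr).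
  move=> x y /free_compP xg /free_compP yg; apply/free_compP => i.
  by rewrite !mxE (gradingD gr) ?(gradingN gr).
- move=> x.
  pose s := undup (flatten [seq [seq l + h | l <- grading_supp gr (x 0 i)]
                                | i <- enum 'I_n]).
  exists s, (fun g => \row_i component gr (g - h) (x 0 i)); split.
  + exact: undup_uniq.
  + by move=> g; apply/free_compP => i; rewrite mxE component_in.
  + apply/rowP => i; rewrite summxE; under eq_bigr do rewrite mxE.
    rewrite -(big_map (fun g => g - h) xpredT (fun g => component gr g (x 0 i))).
    apply: component_sum_sub => [|l ls].
      by rewrite map_inj_uniq ?undup_uniq //; exact: addIr.
    apply/mapP; exists (l + h); rewrite ?addrK // mem_undup.
    by apply/flatten_mapP; exists i; rewrite ?mem_enum //; apply: map_f.
- move=> s f us fC f0 g gs; apply/rowP => i; rewrite mxE.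
  have [_ _ indep] := gr.
  pose f' l := f (l + h) 0 i.
  have f'C l : f' l \in gf_comp F l.
    by have /free_compP/(_ i) := fC (l + h); rewrite addrK.
  rewrite -{1}[g](subrK h) -/(f' (g - h)).
  apply: (indep [seq l - h | l <- s] f') => //.
  + by rewrite map_inj_uniq //; exact: addIr.
  + rewrite big_map; under eq_bigr do rewrite /f' subrK.
    by rewrite -summxE f0 mxE.
  + exact: map_f.
Qed.

Lemma free_comp_scale g l (a : F) (x : 'rV[F]_n) :
  a \in gf_comp F g -> x \in free_comp l -> a *: x \in free_comp (g + l).
Proof.
move=> ag /free_compP xl; apply/free_compP => i.
by rewrite mxE -addrA gf_mul.
Qed.

Definition free_space : gradedSpace F :=
  GradedSpace free_comp_grading free_comp_scale.

End FreeSpace.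

Lemma bilinear_mx_degree n (B : 'M[F]_n) (x y : 'rV[F]_n) g l :
  (forall i j, B i j \in gf_comp F 0) ->
  (forall i, x 0 i \in gf_comp F g) -> (forall i, y 0 i \in gf_comp F l) ->
  (x *m B *m y^T) 0 0 \in gf_comp F (g + l).
Proof.
move=> B0 xg yl; rewrite mxE; apply: (grading_sum (gf_grading F)) => j _.
rewrite !mxE; apply: gf_mul => //.
apply: (grading_sum (gf_grading F)) => i _.
by rewrite -[g]addr0 gf_mul.
Qed.

Variables (c : cosetChoice F) (D : gradeCoset F).
Local Notation hd D := (Defs.half (cc_delta c D)).

Section LiftedForm.
Variables (n : nat) (M : 'M[F0 F]_n).

Let M' : 'M[F]_n := map_mx val M.

Definition lift_form (x : free_space n (hd D)) : F := cc_pi c D * mx_form M' x.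

Lemma polar_lift_form x y :
  polar lift_form x y = cc_pi c D * polar (mx_form M') x y.
Proof. by rewrite /polar /lift_form !mulrBr. Qed.

Lemma lift_form_quadratic : is_quadratic_form lift_form.
Proof.
have [MZ MB] := mx_form_quadratic M'.
apply: is_quadratic_formP => [a x|y a x z]; first by rewrite /lift_form MZ mulrA.
by rewrite !polar_lift_form (MB y).1 mulrDr mulrCA.
Qed.

(** The degree delta of pi_delta compensates the two shifts by delta/2 of the coordinates. *)
Lemma lift_form_degree_sum g l : cc_delta c D + (g - hd D + (l - hd D)) = g + l.
Proof. by rewrite addrACA -opprD -mulr2n Defs.halfK addrCA subrr addr0. Qed.

Lemma lift_form_degree g (x : free_space n (hd D)) :
  x \in gs_comp (free_space n (hd D)) g -> lift_form x \in gf_comp F (g *+ 2).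
Proof.
move=> /free_compP xg; rewrite mulr2n -lift_form_degree_sum.
apply: gf_mul; first exact: cc_pi_in.
by apply: bilinear_mx_degree => // i j; rewrite mxE; exact: valP.
Qed.

Lemma lift_form_polar_degree g l (x y : free_space n (hd D)) :
  x \in gs_comp (free_space n (hd D)) g ->
  y \in gs_comp (free_space n (hd D)) l ->
  polar lift_form x y \in gf_comp F (g + l).
Proof.
move=> /free_compP xg /free_compP yl; rewrite -lift_form_degree_sum.
rewrite polar_lift_form polar_mx_form; apply: gf_mul; first exact: cc_pi_in.
apply: bilinear_mx_degree => // i j; rewrite !mxE.
by rewrite (gradingD (gf_grading F)) //; exact: valP.
Qed.

Definition lift_quad : gradedQuadSpace F :=
  GradedQuadSpace lift_form_quadratic lift_form_degree lift_form_polar_degree.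

(** Over the field F_0, nonsingularity amounts to invertibility of M + M^T, and the inverse matrix
    can simply be mapped into F. The dimension n is kept, and with it the parity. *)
Lemma lift_quad_adm (even : bool) :
  nonsingular (mx_form M) -> (even -> ~~ odd n) ->
  gq_adm even lift_quad.
Proof.
move=> nM en; split; last by exists n; split=> //; exact: has_dim_rV.
have uM := mx_form_nonsingularP nM.
have uM' : M' + M'^T \in unitmx.
  have : map_mx val (M + M^T) *m map_mx val (invmx (M + M^T)) = 1%:M :> 'M[F]_n.
    by rewrite -map_mxM mulmxV // map_mx1.
  by move=> /mulmx1_unit[]; rewrite map_mxD map_trmx.
move=> x x0; apply: (mx_form_nonsingular uM') => y.
by apply: (mulrI (cc_pi_unit c D)); rewrite mulr0 -polar_lift_form x0.
Qed.

Lemma residue_lift_quad :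
  qs_isometric (QuadSpace (mx_form_quadratic M)) (residue c lift_quad D).
Proof.
have degM (x : 'rV[F0 F]_n) :
    map_mx val x \in gs_comp (free_space n (hd D)) (hd D).
  by apply/free_compP => i; rewrite subrr mxE; exact: valP.
have deg0 (x : residue_space c lift_quad D) i :
    (val x : 'rV[F]_n) 0 i \in gf_comp F 0.
  by have /free_compP/(_ i) := valP x; rewrite subrr.
exists (fun x => HomogComp (degM x)); split.
- by move=> a x y; apply: val_inj; apply/rowP => i; rewrite !mxE.
- exists (fun x : residue_space c lift_quad D => \row_i Degree0 (deg0 x i)) => x.
    by apply/rowP => i; apply: val_inj; rewrite mxE /= mxE.
  by apply: val_inj; apply/rowP => i; rewrite !mxE.
- move=> x; apply: val_inj; rewrite /= /lift_form mulKr ?cc_pi_unit //.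
  rewrite /mx_form /M' map_trmx -[@F0_val G F]/(val : F0 F -> F).
  by rewrite -!map_mxM mxE.
Qed.

Lemma residue_lift_quad_neq D' (x : residue_space c lift_quad D') :
  D' <> D -> x = 0.
Proof.
move=> DD; apply: val_inj; apply/rowP => i; rewrite [RHS]mxE.
have /free_compP/(_ i) xi := valP x.
by apply: gf_comp_eq0 xi _ => FD; apply: DD; exact: half_delta_inj FD.
Qed.

End LiftedForm.

End LiftedForms.

(** * The residue isomorphism *)

Section WittClasses.
Variable S : formSystem.
Implicit Types q r h : S.

Lemma witt_class_isom q r :
  fs_isometric q r -> witt_class q = witt_class r :> witt_group S.
Proof. by move=> qr; apply/witt_class_eq/witt_equiv_isom. Qed.

Lemma witt_class_hyperbolic h :
  fs_hyperbolic h -> witt_class h = cm_zero :> witt_group S.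
Proof.
move=> hh; apply/witt_class_eq; exists (fs_zero S), h; split=> //.
  exact: fs_hyperbolic0.
exact: fs_sumC.
Qed.

Lemma witt_class_eq0 q : witt_class q = cm_zero :> witt_group S ->
  exists h h',
    [/\ fs_hyperbolic h, fs_hyperbolic h' & fs_isometric (fs_sum q h) h'].
Proof.
move=> /witt_class_eq[h [h' [hh hh' iso]]]; exists h, h'; split=> //.
exact: fs_isom_trans iso (fs_sum0 _).
Qed.

Lemma cm_addr0 (M : comMonoid) (x : M) : cm_add x cm_zero = x.
Proof. by rewrite cm_addC cm_add0. Qed.

Lemma witt_group_is_group :
  (forall q, exists r, fs_hyperbolic (fs_sum q r)) ->
  is_abelian_group (witt_group S).
Proof.
move=> opp w; rewrite -(witt_reprK w); have [r hr] := opp (witt_repr w).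
by exists (witt_class r); rewrite -[LHS]witt_classD; exact: witt_class_hyperbolic.
Qed.

End WittClasses.

Lemma direct_sum_is_group (I : Type) (M : comMonoid) :
  is_abelian_group M -> is_abelian_group (direct_sum I M).
Proof.
(* The inverse is chosen to be 0 at 0, so that taking inverses coordinatewise preserves finite
   support. *)
move=> gM f; have invP x : exists y : M, cm_add x y = cm_zero /\
    (x = cm_zero -> y = cm_zero).
  have [->|x0] := EM (x = cm_zero); first by exists cm_zero; rewrite cm_add0.
  by have [y xy] := gM x; exists y.
pose inv x := sval (cid (invP x)).
have inv1 x : cm_add x (inv x) = cm_zero := (svalP (cid (invP x))).1.
have inv0 x : x = cm_zero -> inv x = cm_zero := (svalP (cid (invP x))).2.
have fi : fin_supp (fun i => inv (sval f i)).
  by apply: sub_finite_set (svalP f) => i /= + f0; apply; exact: inv0.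
by exists (exist _ _ fi); apply: dsum_eq => i /=.
Qed.

Lemma qs_hyperbolic_trivial (k : fieldType) (q : quadSpace k) :
  (forall x : q, x = 0) -> qs_hyperbolic q.
Proof.
move=> q0; split; first by move=> x _; exact: q0.
exists xpredT, xpredT; split; first split=> //.
- by move=> x; exists 0, 0; rewrite addr0; split=> //; exact: q0.
- by move=> x _; rewrite (q0 x) quadratic0 //; exact: qs_quadratic.
- by move=> x _; rewrite (q0 x) quadratic0 //; exact: qs_quadratic.
Qed.

(** * Opposite forms *)

Section GradedOpposite.
Variables (G : dtfGroupType) (F : gradedField G).

Section Opposite.
Variable q : gradedQuadSpace F.

Lemma gq_opp_degree g (x : q) :
  x \in gs_comp q g -> - gq_form x \in gf_comp F (g *+ 2).
Proof. by move=> xg; apply: (gradingN (gf_grading F)); exact: gq_degree. Qed.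

Lemma gq_opp_polar_degree g h (x y : q) :
  x \in gs_comp q g -> y \in gs_comp q h ->
  polar (fun x : q => - gq_form x) x y \in gf_comp F (g + h).
Proof.
move=> xg yh; rewrite polar_opp.
by apply: (gradingN (gf_grading F)); exact: gq_polar_degree.
Qed.

Definition gq_opp : gradedQuadSpace F :=
  GradedQuadSpace (opp_quadratic (gq_quadratic q)) gq_opp_degree
    gq_opp_polar_degree.

End Opposite.

Lemma residue_opp (c : cosetChoice F) (q : gradedQuadSpace F) D :
  qs_isometric (residue c (gq_opp q) D) (qs_opp (residue c q D)).
Proof.
exists id; split=> //; first by exists id.
by move=> x; apply: val_inj; rewrite /= mulrN.
Qed.

Lemma qs_isometric_sum (k : fieldType) (q q' r r' : quadSpace k) :
  qs_isometric q q' -> qs_isometric r r' ->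
  qs_isometric (qs_sum q r) (qs_sum q' r').
Proof.
move=> [f fP] [g gP].
by exists (fun x => (f x.1, g x.2)); exact: isometry_sum.
Qed.

Lemma qs_isometric_sym (k : fieldType) (q r : quadSpace k) :
  qs_isometric q r -> qs_isometric r q.
Proof.
by move=> [f fP]; have [_ [g fK gK] _] := fP; exists g; exact: isometry_inv fP.
Qed.

Lemma qs_isometric_trans (k : fieldType) (q r s : quadSpace k) :
  qs_isometric q r -> qs_isometric r s -> qs_isometric q s.
Proof. by move=> [f fP] [g gP]; exists (g \o f); exact: isometry_comp gP. Qed.

(** Each residue is isometric to r _|_ -r, so the result over fields applies and
    [hyperbolic_of_residues] carries it to F. Residues are taken with parity [false], because those
    of an even-dimensional form may have odd dimension; hyperbolicity of r _|_ -r does not depend on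
    it. *)
Lemma gq_sum_opp_hyperbolic (c : cosetChoice F) even (q : gradedQuadSpace F) :
  gq_adm even q -> gq_hyperbolic (gq_sum q (gq_opp q)).
Proof.
move=> aq; apply: (hyperbolic_of_residues (c := c)) => [|D].
  apply: orth_sum_nonsingular; first exact: gq_quadratic.
  - exact: (gq_quadratic (gq_opp q)).
  - exact: aq.1.
  - exact: nonsingular_opp aq.1.
have aqD : qs_adm false (residue c q D).
  by apply: residue_adm; case: aq => nq [n [dn _]]; split=> //; exists n.
apply: qs_hyperbolic_isometric (qs_sum_opp_hyperbolic aqD).
apply: qs_isometric_sym; apply: qs_isometric_trans (residue_sum _ _ _ _) _.
by apply: qs_isometric_sum (residue_opp _ _ _); exists id; exact: isometry_id.
Qed.

End GradedOpposite.

Section ResidueMap.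
Variables (G : dtfGroupType) (F : gradedField G) (c : cosetChoice F).
Variable even : bool.
(** The one input sensitive to parity; with it as a hypothesis, the same argument serves both kinds
    of Witt group. *)
Hypothesis radm : forall (q : gnsForm F even) (D : gradeCoset F),
  qs_adm even (residue c (sval q) D).
Implicit Types (q r : gnsForm F even) (D : gradeCoset F).

Local Notation GS := (gnsForm_system F even).
Local Notation RS := (nsForm_system (F0 F) even).

Definition residue_ns q D : RS := exist _ (residue c (sval q) D) (radm q D).

Definition residue_class q D : witt_group RS := witt_class (residue_ns q D).

Lemma residue_class_hyperbolic q D :
  qs_hyperbolic (residue c (sval q) D) -> residue_class q D = cm_zero.
Proof. by move=> hq; apply: witt_class_hyperbolic. Qed.

Lemma residue_class0 D : residue_class (fs_zero GS) D = cm_zero.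
Proof.
apply: residue_class_hyperbolic; apply: residue_hyperbolic.
exact: (fs_hyperbolic0 GS).
Qed.

Lemma residue_classD q r D : residue_class (fs_sum (f := GS) q r) D =
  cm_add (residue_class q D) (residue_class r D).
Proof.
rewrite /residue_class -[RHS]witt_classD; apply: witt_class_isom.
exact: residue_sum.
Qed.

Lemma residue_class_equiv q r D : @witt_equiv GS q r ->
  residue_class q D = residue_class r D.
Proof.
move=> [h [h' [hh hh' iso]]].
rewrite -[LHS]cm_addr0 -[RHS]cm_addr0.
rewrite -[in LHS](residue_class_hyperbolic (residue_hyperbolic c D hh)).
rewrite -[in RHS](residue_class_hyperbolic (residue_hyperbolic c D hh')).
rewrite -!residue_classD; apply: witt_class_isom.
exact: residue_isometric iso.
Qed.

Lemma ex_lift D (r : RS) : exists q : gnsForm F even,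
  qs_isometric (residue c (sval q) D) (sval r) /\
  forall D', D' <> D -> qs_hyperbolic (residue c (sval q) D').
Proof.
have [nr [n [dn en]]] := svalP r.
have [M [f fP]] := isometry_mx_form (qs_quadratic (sval r)) dn.
have [_ [g fK gK] _] := fP; have gP := isometry_inv fK gK fP.
have aM := lift_quad_adm c D (isometry_nonsingular gP nr) en.
exists (exist _ _ aM); split=> [|D' DD].
  apply: (qs_isometric_trans (qs_isometric_sym (residue_lift_quad _ _ _))).
  by exists f.
by apply: qs_hyperbolic_trivial => x; exact: residue_lift_quad_neq DD.
Qed.

Lemma gnsForm_opp q : exists r : GS, fs_hyperbolic (fs_sum (f := GS) q r).
Proof.
have aq : gq_adm even (gq_opp (sval q)).
  by have [nq dq] := svalP q; split=> //; exact: nonsingular_opp.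
exists (exist _ _ aq).
change (gq_hyperbolic (gq_sum (sval q) (gq_opp (sval q)))).
exact: (gq_sum_opp_hyperbolic c (svalP q)).
Qed.

Lemma nsForm_opp (r : RS) : exists s : RS, fs_hyperbolic (fs_sum r s).
Proof.
have ar : qs_adm even (qs_opp (sval r)).
  by have [nr dr] := svalP r; split=> //; exact: nonsingular_opp.
exists (exist _ _ ar).
exact: qs_sum_opp_hyperbolic (svalP r).
Qed.

Lemma residue_class_fin_supp q : fin_supp (residue_class q).
Proof.
have [_ [n [dn _]]] := svalP q.
apply: sub_finite_set (finite_nonzero_residues c dn) => D /=.
apply: contra_notP => ND; apply: residue_class_hyperbolic.
apply: qs_hyperbolic_trivial => x; apply: contrapT => x0; apply: ND.
by exists x; apply/eqP.
Qed.

Definition residue_map (w : graded_witt_group even F) :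
    residue_witt_group even F :=
  exist _ _ (residue_class_fin_supp (witt_repr w)).

Lemma residue_mapE q D :
  dsum_coord (residue_map (witt_class (q : GS))) D = residue_class q D.
Proof. by apply: residue_class_equiv; apply/witt_class_eq; exact: witt_reprK. Qed.

(* Adding the lift of a hyperbolic form makes one more residue hyperbolic. *)
Lemma residue_class_ker (s : seq {classic gradeCoset F}) q :
  (forall D, residue_class q D = cm_zero) ->
  (forall D : {classic gradeCoset F}, D \notin s ->
    qs_hyperbolic (residue c (sval q) D)) ->
  witt_class (q : GS) = cm_zero :> witt_group GS.
Proof.
elim: s q => [|D s IHs] q q0 hq.
  apply: witt_class_hyperbolic.
  by apply: (hyperbolic_of_residues (c := c) (svalP q).1) => D; exact: hq.
have [h [h' [hh hh' iso]]] := witt_class_eq0 (q0 D).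
have [l [lD lD']] := ex_lift D h.
have hl : fs_hyperbolic (l : GS).
  apply: (hyperbolic_of_residues (c := c) (svalP l).1) => D'.
  have [->|DD] := EM (D' = D); last exact: lD'.
  exact: qs_hyperbolic_isometric (qs_isometric_sym lD) hh.
have -> : witt_class (q : GS) = witt_class (fs_sum (q : GS) l) :> witt_group GS.
  rewrite [RHS]witt_classD [X in witt_add _ X](witt_class_hyperbolic hl).
  exact: esym (cm_addr0 (witt_class (q : GS) : witt_group GS)).
apply: IHs => [D'|D' D's].
  rewrite residue_classD q0 cm_add0; apply: residue_class_hyperbolic.
  exact: residue_hyperbolic.
apply: qs_hyperbolic_isometric (qs_isometric_sym (residue_sum _ _ _ _)) _.
have [DD|DD] := EM (D' = D).
  subst D'; apply: qs_hyperbolic_isometric hh'; apply: qs_isometric_sym.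
  apply: qs_isometric_trans iso; apply: qs_isometric_sum => //.
  by exists id; exact: isometry_id.
apply: (@nsForm_hyperbolicD _ even (residue_ns q D') (residue_ns l D')).
  by apply: hq; rewrite inE negb_or D's andbT; apply/eqP.
exact: lD'.
Qed.

Lemma residue_map_isomorphism : is_residue_isomorphism c residue_map.
Proof.
have gG : is_abelian_group (graded_witt_group even F).
  exact: (witt_group_is_group (S := GS) gnsForm_opp).
have gR : is_abelian_group (residue_witt_group even F).
  exact: (direct_sum_is_group (witt_group_is_group (S := RS) nsForm_opp)).
have phiD v w : residue_map (cm_add v w) = cm_add (residue_map v) (residue_map w).
  apply: dsum_eq => D; rewrite -[v in LHS]witt_reprK -[w in LHS]witt_reprK.
  have -> : cm_add (witt_class (witt_repr v) : witt_group GS)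
      (witt_class (witt_repr w)) = witt_class (fs_sum (witt_repr v) (witt_repr w)).
    exact: esym (witt_classD _ _).
  by rewrite [LHS]residue_mapE residue_classD.
have ker v : residue_map v = cm_zero -> v = cm_zero.
  rewrite -(witt_reprK v) => v0.
  have [_ [n [dn _]]] := svalP (witt_repr v).
  have /finite_seqP[s sE] := finite_nonzero_residues c dn
    : finite_set (_ : set {classic gradeCoset F}).
  apply: (@residue_class_ker s) => [D|D Ds]; first by rewrite -residue_mapE v0.
  apply: qs_hyperbolic_trivial => x; apply: contrapT => /eqP x0.
  move/negP: Ds; apply.
  have : [set` s]%classic D by rewrite -sE; exists x.
  by [].
have inj : injective residue_map.
  move=> v w vw; have [w' ww'] := gG w.
  have : cm_add v w' = cm_zero.
    apply: ker; rewrite phiD vw -phiD ww'.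
    apply: dsum_eq => D; rewrite -/(dsum_coord _ _) [LHS]residue_mapE.
    exact: residue_class0.
  by move=> vw0; rewrite -[LHS]cm_addr0 -ww' (cm_addC w) cm_addA vw0 cm_add0.
have surj f : exists w, residue_map w = f.
  suff [q qf] : exists q : GS, forall D, residue_class q D = sval f D.
    exists (witt_class q); apply: dsum_eq => D.
    by rewrite -/(dsum_coord _ _) residue_mapE.
  have /finite_seqP[s sE] := svalP f : finite_set (_ : set {classic gradeCoset F}).
  have {sE} : forall D : {classic gradeCoset F}, D \notin s -> sval f D = cm_zero.
    move=> D /negP Ds; apply: contrapT => fD; apply: Ds.
    by have : [set` s]%classic D by rewrite -sE.
  (* Induction on a list of cosets outside which f vanishes: f with its value at D erased is
     realised by some q, and the lift of a representative of [f D] adds the missing coordinate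
     without disturbing the others. *)
  elim: s (sval f) => [|D s IHs] {}f f0.
    exists (fs_zero GS) => D; rewrite f0 //.
    exact: residue_class0.
  pose f' D' := if pselect (D' = D) then cm_zero else f D'.
  have f'D : f' D = cm_zero by rewrite /f'; case: pselect.
  have f'N D' : D' <> D -> f' D' = f D' by rewrite /f'; case: pselect.
  have [D' D's|q qf'] := IHs f'.
    have [->//|DD] := EM (D' = D); rewrite f'N //; apply: f0.
    by rewrite inE negb_or D's andbT; apply/eqP.
  have [l [lD lD']] := ex_lift D (witt_repr (f D)).
  exists (fs_sum q l) => D'; rewrite residue_classD qf'.
  have [->|DD] := EM (D' = D).
    rewrite f'D cm_add0 -[RHS]witt_reprK; exact: witt_class_isom.
  rewrite f'N // [X in cm_add _ X]residue_class_hyperbolic ?cm_addr0 //.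
  exact: lD'.
split; last by exists radm => q D; exact: residue_mapE.
split=> //; exists (fun f => sval (cid (surj f))).
  by move=> w; apply: inj; exact: svalP (cid (surj _)).
by move=> f; exact: svalP (cid (surj f)).
Qed.

End ResidueMap.

(** * Parity of the dimensions of residues *)

Section Parity.
Variables (G : dtfGroupType) (F : gradedField G).

(* An odd set-theoretic section of G -> G / Gamma_F outside the 2-torsion. *)
Lemma ex_coset_repr (P : pred G) :
  (forall g h, grade_set F (g - h) -> P g = P h) ->
  (forall g, ~ grade_set F (g *+ 2) -> P (- g) = ~~ P g) ->
  exists rep : G -> G, [/\ forall g, grade_set F (rep g - g),
    forall g h, grade_set F (g - h) -> rep g = rep h
  & forall g, ~ grade_set F (g *+ 2) -> rep (- g) = - rep g].
Proof.
move=> Pcoset Psign; pose B g := [set h | grade_set F (h - g)]%classic.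
pose rep0 g := xget 0 (B g).
have rep0P g : grade_set F (rep0 g - g).
  rewrite /rep0; case: xgetP => [h _ //|/(_ g)[]].
  by rewrite /B /= subrr; exact: grade_set0.
have rep0_eq g h : grade_set F (g - h) -> rep0 g = rep0 h.
  move=> Fgh; rewrite /rep0; congr xget; apply/funext => l; apply/propext.
  split=> Fl; first exact: grade_set_trans Fl Fgh.
  exact: grade_set_trans Fl (grade_setBC Fgh).
exists (fun g => if P g then rep0 g else - rep0 (- g)); split.
- move=> g; case: ifP => _ //.
  by have := grade_setN (rep0P (- g)); rewrite opprB addrC.
- move=> g h Fgh; rewrite (Pcoset _ _ Fgh); case: ifP => _.
    exact: rep0_eq.
  by congr (- _); apply: rep0_eq; rewrite opprK addrC; exact: grade_setBC.
- by move=> g Ng; rewrite (Psign _ Ng) opprK; case: (P g); rewrite ?opprK.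
Qed.

Lemma F0_val_sum (I : Type) (s : seq I) (f : I -> F0 F) :
  val (\sum_(i <- s) f i) = \sum_(i <- s) val (f i).
Proof. exact: raddf_sum. Qed.

Variables (q : gradedQuadSpace F) (n : nat) (e : 'I_n -> q) (d : 'I_n -> G).
Hypotheses (nq : nonsingular (@gq_form _ _ q)) (eB : is_basis e).
Hypothesis ed : forall i, e i \in gs_comp q (d i).

Local Notation b := (polar (@gq_form _ _ q)).

Lemma polar_basis_eq0 i j : ~ grade_set F (d i + d j) -> b (e i) (e j) = 0.
Proof. by move=> NF; apply: gf_comp_eq0 (gq_polar_degree (ed i) (ed j)) NF. Qed.

Lemma nonsingular_basis x : (forall j, b x (e j) = 0) -> x = 0.
Proof.
move=> x0; apply: nq => y; have Qq := gq_quadratic q.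
have [a ->] := is_basis_span y eB; rewrite polar_sumr // big1 // => i _.
by rewrite polarZr // x0 mulr0.
Qed.

Let T := [set i | `[< ~ grade_set F (d i *+ 2) >]].

(* After normalising degrees, the Gram matrix of the basis vectors of degrees
   outside 1/2 Gamma_F has entries in F_0; twisted by the sign P, which differs
   on g and - g, it becomes alternating. *)
Lemma even_card_nontorsion : ~~ odd #|T|.
Proof.
have Qq := gq_quadratic q; have [P [Pcoset Psign]] := ex_coset_sign F.
have [rep [repP rep_eq repN]] := ex_coset_repr Pcoset Psign.
have TP (i : 'I_#|T|) : ~ grade_set F (d (enum_val i) *+ 2).
  by apply/asboolP; have := enum_valP i; rewrite inE.
pose u i := homog_unit F (rep (d i) - d i).
have uu i : u i \is a GRing.unit := homog_unit_unit _ _.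
pose v i := u i *: e i.
have vP i : v i \in gs_comp q (rep (d i)).
  by have := gs_scale (homog_unit_in (repP (d i))) (ed i); rewrite subrK.
pose t (i : 'I_#|T|) := enum_val i.
have opposite i j : b (v (t i)) (v (t j)) != 0 -> grade_set F (d (t i) - - d (t j)).
  rewrite opprK => b0; apply: contrapT => NF; move/eqP: b0; apply.
  by rewrite /v polarZl // polarZr // polar_basis_eq0 ?mulr0.
have b_in0 i j : b (v (t i)) (v (t j)) \in gf_comp F 0.
  have [->|/opposite Fij] := eqVneq (b (v (t i)) (v (t j))) 0.
    exact: (grading0 (gf_grading F)).
  (* A nonzero value forces opposite cosets of degrees, and as [rep] is odd there, the normalised
     degrees add up to 0. *)
  have := gq_polar_degree (vP (t i)) (vP (t j)).
  by rewrite (rep_eq _ _ Fij) repN ?addNr //; exact: TP.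
have b_sign i j : b (v (t i)) (v (t j)) != 0 -> P (d (t i)) = ~~ P (d (t j)).
  by move=> /opposite Fij; rewrite (Pcoset _ _ Fij) Psign //; exact: TP.
pose s i : F := (-1) ^+ ~~ P (d (t i)).
pose N : 'M[F0 F]_#|T| :=
  \matrix_(i, j) if P (d (t i)) then Degree0 (b_in0 i j) else 0.
have NE i j : val (N i j) = if P (d (t i)) then b (v (t i)) (v (t j)) else 0.
  by rewrite mxE; case: ifP.
(* A difference N - N^T is alternating in every characteristic. As the sign differs on opposite
   cosets, only one of the two terms survives in each entry, so A is the Gram matrix with rows
   multiplied by signs. *)
pose A := N - N^T.
have AE i j : val (A i j) = s i * b (v (t i)) (v (t j)).
  have -> : A i j = N i j - N j i.
    by rewrite /A mxE [X in _ + X]mxE [in X in _ - X]mxE.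
  rewrite -[LHS]/(val (N i j) - val (N j i)) !NE /s.
  have bC := polarC (@gq_form _ _ q) (v (t i)) (v (t j)).
  have [b0|/b_sign Pij] := eqVneq (b (v (t i)) (v (t j))) 0.
    rewrite b0 mulr0; case: (P (d (t i))); case: (P (d (t j)));
    by rewrite /= ?b0 -?bC ?b0 ?subr0.
  by rewrite Pij; case: (P (d (t j))); rewrite /= -?bC ?subr0 ?sub0r ?mulN1r ?mul1r.
apply: (@alternating_unitmx_even _ _ A) => [|x]; last first.
  rewrite /A mulmxBr mulmxBl.
  have -> : x *m N^T *m x^T = (x *m N *m x^T)^T by rewrite !trmx_mul trmxK mulmxA.
  by rewrite !mxE subrr.
rewrite -row_free_unit; apply: inj_row_free => y yA.
(* A row vector killed by A yields a vector z orthogonal to all basis vectors indexed by T. Those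
   outside T are orthogonal to z by degree, so z = 0 and its coefficients vanish. *)
pose z := \sum_i (val (y 0 i) * s i) *: v (t i).
have zT j : b z (v (t j)) = 0.
  transitivity (val ((y *m A) 0 j)); last by rewrite yA mxE.
  rewrite mxE F0_val_sum polar_suml //; apply: eq_bigr => i _.
  by rewrite polarZl // -mulrA -AE.
have z0 : z = 0.
  apply: nonsingular_basis => k; have [kT|kT] := boolP (k \in T).
    have := zT (enum_rank_in kT k); rewrite /t enum_rankK_in // /v polarZr //.
    by move=> zk; apply: (mulrI (uu k)); rewrite zk mulr0.
  rewrite polar_suml // big1 // => i _; rewrite polarZl // /v polarZl //.
  rewrite polar_basis_eq0 ?mulr0 // => Fik.
  have Fk : grade_set F (d k *+ 2).
    by apply: contrapT => Nk; move/negP: kT; apply; rewrite inE; apply/asboolP.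
  apply: (TP i); have -> : d (t i) *+ 2 = (d (t i) + d k) *+ 2 - d k *+ 2.
    by rewrite mulrnDl addrK.
  by apply: grade_setB Fk; rewrite mulr2n; exact: grade_setD.
pose a k : F :=
  if [pick i | t i == k] is Some i then val (y 0 i) * s i * u k else 0.
have aE i : a (t i) = val (y 0 i) * s i * u (t i).
  rewrite /a; case: pickP => [j /eqP/enum_val_inj -> //|/(_ i)].
  by rewrite eqxx.
have a0 k : a k = 0.
  apply: (is_basis_free (c := a) eB).
  rewrite (bigID (mem T)) /= [X in _ + X]big1 ?addr0 => [|i iT]; last first.
    rewrite /a; case: pickP => [j /eqP ji|_]; last by rewrite scale0r.
    by have := enum_valP j; rewrite -/(t j) ji (negPf iT).
  rewrite big_enum_val -[RHS]z0; apply: eq_bigr => i _.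
  by rewrite -/(t i) aE /v scalerA.
apply/rowP => i; apply: val_inj; rewrite [RHS]/= mxE.
have us : s i * u (t i) \is a GRing.unit.
  by rewrite unitrMl // /s unitrX // unitrN1.
by apply: (mulIr us); rewrite mulrA -aE a0 mul0r.
Qed.

End Parity.

(** Two separate reasons. If 2 = 0, the polar form of the residue is alternating, as b(x, x) = 2
    q(x). If Gamma_F = 2 Gamma_F, then 2g in Gamma_F forces g in Gamma_F, so the basis vectors not
    counted by the residue are exactly those counted in [even_card_nontorsion], and subtracting
    their even number preserves parity. *)
Lemma residue_adm_even (G : dtfGroupType) (F : gradedField G)
    (c : cosetChoice F) (q : gradedQuadSpace F) (D : gradeCoset F) :
  (2%:R = 0 :> F) \/ grade_set F = double_grade_set F ->
  gq_adm true q -> qs_adm true (residue c q D).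
Proof.
move=> char2_or_div [nq [n [dn en]]].
have nD := residue_nonsingular (c := c) (D := D) nq.
have [e [d [eB ed]]] := homogeneous_basis dn.
have dD := homogComp_has_dim eB ed (Defs.half (cc_delta c D)).
split=> //; eexists; split; first exact: dD.
move=> _; case: char2_or_div => [two0|FF].
  have [M [f fP]] := isometry_mx_form (qs_quadratic (residue c q D)) dD.
  have [_ [g fK gK] _] := fP.
  have uM := mx_form_nonsingularP (isometry_nonsingular (isometry_inv fK gK fP) nD).
  apply: (alternating_unitmx_even uM) => x.
  rewrite -polar_mx_form polar_diag; last exact: mx_form_quadratic.
  rewrite -mulr_natr; have -> : 2%:R = 0 :> F0 F by apply: val_inj; rewrite /= -two0.
  exact: mulr0.
have Fhalf g : grade_set F (g *+ 2) -> grade_set F g.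
  rewrite {1}FF => -[h Fh gh]; have -> // : g = h.
  by rewrite -[g]half_mulr2n -gh half_mulr2n.
have := even_card_nontorsion nq eB ed; have := en isT.
set S := [set i | _]; set T := [set i | _].
have -> : T = ~: S.
  apply/setP => i; rewrite !inE -asbool_neg; apply: asbool_equiv_eq.
  have FD : grade_set F (Defs.half (cc_delta c D)).
    by apply: Fhalf; rewrite Defs.halfK; exact: cc_delta_grade_set.
  split=> [FDi Ni|/contrapT Fi]; last exact: grade_setB FD (Fhalf _ Fi).
  apply: Ni; have := grade_setB FD FDi; rewrite opprB addrC subrK mulr2n => Fi.
  exact: grade_setD.
by rewrite -{1}[n]card_ord -(cardsC S) oddD; case: (odd #|S|); case: (odd _).
Qed.

(** * Dependence on the choice of homogeneous elements *)

Section Anisotropic.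
Variable k : fieldType.

(** A linear functional that vanishes on S but not at a comes from a column of the cokernel matrix
    of S; the invertible Gram matrix represents it by a vector z. *)
Lemma nonsingular_separation even (q : quadSpace k) (S : {pred q}) a :
  qs_adm even q -> submod_closed S -> a \notin S ->
  exists z, (forall s, s \in S -> polar (@qs_form _ q) z s = 0) /\
    polar (@qs_form _ q) z a <> 0.
Proof.
move=> [nq [n [dn _]]] [S0 SZ] aS.
have [M [f fP]] := isometry_mx_form (qs_quadratic q) dn.
have [fl [g fK gK] _] := fP.
have uB := mx_form_nonsingularP (isometry_nonsingular (isometry_inv fK gK fP) nq).
(* S is given only as a predicate; a matrix of maximal rank with row space inside S then describes
   all of S. *)
pose P (X : 'M[k]_n) := forall v : 'rV_n, (v <= X)%MS -> f v \in S.
have [|X PX maxX] := ex_max_rank (P := P).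
  by move=> v; rewrite submx0 => /eqP ->; rewrite linear_map0.
have SX s : s \in S -> (g s <= X)%MS.
  move=> sS; apply/negPn/negP => sX.
  have : P (X + g s)%MS.
    move=> v /sub_addsmxP[[u1 u2] /= ->].
    rewrite linear_mapD // addrC (mx11_scalar u2) mul_scalar_mx.
    rewrite linear_mapZ // gK SZ //.
    by apply: PX; exact: submxMl.
  move=> /maxX; rewrite leqNgt => /negP[].
  have := mxrank_leqif_sup (addsmxSl X (g s)).
  rewrite addsmx_sub submx_refl (negPf sX) /= => -[le neq].
  by rewrite ltn_neqAle neq le.
have : ~~ (g a <= X)%MS by apply: contraNN aS => /PX; rewrite gK.
rewrite submxE => /rV0Pn[j aj].
pose z := (col j (cokermx X))^T *m invmx (M + M^T).
have zE y : polar (@qs_form _ q) (f z) y = (g y *m cokermx X) 0 j.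
  rewrite -{1}[y]gK (isometry_polar _ _ fP) polar_mx_form mulmxKV //.
  by rewrite -trmx_mul mxE colE mulmxA -colE mxE.
exists (f z); split=> [s /SX|].
  by rewrite submxE zE => /eqP ->; rewrite mxE.
by rewrite zE; apply/eqP.
Qed.

(* A vector (a, 0) not in L + U, for totally singular complemented L and U,
   is separated from it by some z orthogonal to both; then z lies in L and has
   a totally singular, hence zero, component in p. *)
Lemma anisotropic_witt_trivial even (p h h' : quadSpace k) :
  qs_adm even p -> qs_adm even h ->
  qs_hyperbolic h -> qs_hyperbolic h' -> qs_isometric (qs_sum p h) h' ->
  (forall x : p, qs_form x = 0 -> x = 0) -> forall x : p, x = 0.
Proof.
move=> ap ah hh hh' iso anis a.
have aV : qs_adm even (qs_sum p h).
  by apply: admissible_orth_sum => //; exact: qs_quadratic.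
have [nV [L [L' [[Ls L's dL cL] qL qL']]]] : qs_hyperbolic (qs_sum p h).
  have [f fP] := iso; have [_ [g fK gK] _] := fP.
  apply: qs_hyperbolic_isometric hh'; exists g; exact: isometry_inv fP.
have [nh [U [W [[Us Ws dU cU] qU qW]]]] := hh.
have isotropic (q : quadSpace k) (A : {pred q}) : submod_closed A ->
    vanishes_on (@qs_form _ q) A ->
    forall x y, x \in A -> y \in A -> polar (@qs_form _ q) x y = 0.
  move=> [A0 AZ] qA x y xA yA; rewrite /polar -[x]scale1r.
  by rewrite !qA ?subrr // ?AZ // scale1r.
(* A totally singular A with a totally singular complement B contains its orthogonal: the B-part of
   a vector orthogonal to A is orthogonal to A and to B, hence zero. *)
have orthogonal (q : quadSpace k) (A B : {pred q}) : nonsingular (@qs_form _ q) ->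
    submod_closed B -> vanishes_on (@qs_form _ q) B -> submod_closed A ->
    vanishes_on (@qs_form _ q) A ->
    (forall x, exists u w, [/\ u \in A, w \in B & x = u + w]) ->
    forall x, (forall y, y \in A -> polar (@qs_form _ q) x y = 0) -> x \in A.
  move=> nq Bs qB As qA dAB x xA; have Qq := qs_quadratic q.
  have [u [w [uA wB xE]]] := dAB x.
  suff w0 : w = 0 by rewrite xE w0 addr0.
  apply: nq => y; have [u' [w' [u'A w'B ->]]] := dAB y.
  rewrite polarDr // [X in _ + X](isotropic _ B) // addr0.
  by have := xA _ u'A; rewrite xE polarDl // (isotropic _ A) // add0r.
have QV := qs_quadratic (qs_sum p h).
pose LU : {pred qs_sum p h} := [pred x | `[< exists l u,
  [/\ l \in L, u \in U & x = l + (0, u)] >]].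
have LUs : submod_closed LU.
  have [L0 LZ] := Ls; have [U0 UZ] := Us; split.
    by apply/asboolP; exists 0, 0; rewrite addr0.
  move=> b x y /asboolP[l [u [lL uU ->]]] /asboolP[l' [u' [l'L u'U ->]]].
  apply/asboolP; exists (b *: l + l'), (b *: u + u'); split; [exact: LZ|exact: UZ|].
  rewrite scalerDr addrACA; congr (_ + _).
  by congr (_, _); rewrite /= scaler0 addr0.
have [/asboolP[l [u [lL uU aE]]]|aLU] := boolP (((a, 0) : qs_sum p h) \in LU).
  (* If (a, 0) = l + (0, u), then l = (a, -u) is singular and so is u, which makes a singular in the
     anisotropic p. *)
  have lE : l = (a, - u) :> qs_sum p h.
    by apply: (addIr (0, u)); rewrite -aE; congr (_, _); rewrite /= ?addr0 ?addNr.
  apply: anis; have := qL _ lL; rewrite lE /= /orth_sum /=.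
  rewrite (qU (- u)) ?addr0 //; have [U0 UZ] := Us.
  by have := UZ (-1) u 0 uU U0; rewrite scaleN1r addr0.
have [z [zLU za]] := nonsingular_separation aV LUs aLU.
have [L0 LZ] := Ls; have [U0 UZ] := Us.
have zL : z \in L.
  apply: (orthogonal _ L L') => // y yL; apply: zLU; apply/asboolP.
  by exists y, 0; rewrite addr0.
have zU : z.2 \in U.
  apply: (orthogonal _ U W) => // y yU.
  have : ((0, y) : qs_sum p h) \in LU by apply/asboolP; exists 0, y; rewrite add0r.
  move=> /zLU; rewrite [LHS]polar_orth_sum /= polar0r ?add0r //.
  exact: qs_quadratic.
case: za; rewrite [LHS]polar_orth_sum /= polar0r ?addr0; last exact: qs_quadratic.
have -> : z.1 = 0.
  by apply: anis; have := qL _ zL; rewrite /= /orth_sum qU // addr0.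
by rewrite polarC polar0r //; exact: qs_quadratic.
Qed.

End Anisotropic.

(** * Laurent polynomials over Q as a graded field *)

Section Laurent.

Local Notation K := {fraction {poly rat}}.
Local Notation "p %:F" := (FracField.tofrac p).
Local Notation t := ('X%:F : K).

Lemma laurent_var_neq0 : t != 0.
Proof. by rewrite tofrac_eq0 polyX_eq0. Qed.

Definition laurent : {pred K} :=
  [pred x | `[< exists (n : nat) (p : {poly rat}), x * t ^+ n = p%:F >]].

Lemma laurentP (x : K) : reflect
  (exists (n : nat) (p : {poly rat}), x * t ^+ n = p%:F) (x \in laurent).
Proof. exact: asboolP. Qed.

Fact laurent_subring_closed : subring_closed laurent.
Proof.
split.
- by apply/laurentP; exists 0, 1; rewrite mulr1 tofrac1.
- move=> x y /laurentP[m [p xp]] /laurentP[n [r yr]]; apply/laurentP.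
  exists (m + n)%N, (p * 'X^n - r * 'X^m).
  rewrite tofracB !tofracM !tofracXn -xp -yr exprD; ring.
- move=> x y /laurentP[m [p xp]] /laurentP[n [r yr]]; apply/laurentP.
  by exists (m + n)%N, (p * r); rewrite tofracM -xp -yr exprD mulrACA.
Qed.
HB.instance Definition _ :=
  GRing.isSubringClosed.Build K laurent laurent_subring_closed.

Record laurentPoly := LaurentPoly { lp_val : K; lp_valP : lp_val \in laurent }.

HB.instance Definition _ := [isSub for lp_val].
HB.instance Definition _ := [Choice of laurentPoly by <:].
HB.instance Definition _ := [SubChoice_isSubComNzRing of laurentPoly by <:].

Definition lp_unit : {pred laurentPoly} :=
  [pred x | (val x != 0) && ((val x)^-1 \in laurent)].

(** The default of [insubd] is x itself, because the inverse has to be the identity on nonunits. *)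
Definition lp_inv (x : laurentPoly) : laurentPoly := insubd x (val x)^-1.

Fact lp_mulVx : {in lp_unit, left_inverse 1 lp_inv *%R}.
Proof.
move=> x /andP[x0 xV]; apply: val_inj.
by rewrite /= -[lp_val _]/(val _) /lp_inv val_insubd xV mulVf.
Qed.

Fact lp_unitPl x y : y * x = 1 -> lp_unit x.
Proof.
move=> /(congr1 val) /= yx; have x0 : val x != 0.
  by apply: contra_eq_neq yx => x0; rewrite [lp_val x]x0 mulr0 eq_sym oner_neq0.
rewrite /lp_unit /= x0 /= -[(lp_val x)^-1]mul1r -yx mulfK //; exact: valP.
Qed.

Fact lp_inv_out : {in [predC lp_unit], lp_inv =1 id}.
Proof.
move=> x; rewrite inE /= -[x \in lp_unit]/(_ && _) negb_and negbK => xN.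
apply: val_inj; rewrite val_insubd; case: ifP => // xV.
by move: xN; rewrite xV orbF => /eqP ->; rewrite invr0.
Qed.

HB.instance Definition _ := GRing.ComNzRing_hasMulInverse.Build laurentPoly
  lp_mulVx lp_unitPl lp_inv_out.

(** Degrees range over Q because the grading group must be divisible; nonintegral degrees receive
    the zero component. *)
Definition monomial_val (g : rat) : K := if g \is a Num.int then t ^ numq g else 0.

Lemma monomial_val_int (z : int) : monomial_val z%:~R = t ^ z.
Proof. by rewrite /monomial_val Num.Theory.intr_int numq_int. Qed.

(** The scalar is 1 for integral degrees and 0 otherwise; it is needed because two nonintegral
    degrees may have an integral sum. *)
Lemma monomial_valM g h : exists a,
  monomial_val g * monomial_val h = a%:P%:F * monomial_val (g + h).
Proof.
have zeroP : exists a, 0 = a%:P%:F * monomial_val (g + h).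
  by exists 0; rewrite rmorph0 mul0r.
have [gz|gN] := boolP (g \is a Num.int); last first.
  by rewrite /monomial_val (negPf gN) mul0r.
have [hz|hN] := boolP (h \is a Num.int); last first.
  by rewrite {2}/monomial_val (negPf hN) mulr0.
exists 1; rewrite -(numqK gz) -(numqK hz) -intrD !monomial_val_int.
by rewrite rmorph1 mul1r expfzDr // laurent_var_neq0.
Qed.

Lemma monomial_val_in a g : a%:P%:F * monomial_val g \in laurent.
Proof.
apply/laurentP; rewrite /monomial_val; case: ifP => _; last first.
  by exists 0, 0; rewrite mulr0 mul0r rmorph0.
case: (numq g) => n.
  by exists 0, (a%:P * 'X^n); rewrite mulr1 tofracM tofracXn.
exists n.+1, a%:P; rewrite NegzE -exprnN mulfVK //.
by rewrite expf_neq0 ?laurent_var_neq0.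
Qed.

Definition monomial a g : laurentPoly := LaurentPoly (monomial_val_in a g).

Definition lp_comp (g : rat) : {pred laurentPoly} :=
  [pred x | `[< exists a, x = monomial a g >]].

Lemma lp_compP g x : reflect (exists a, x = monomial a g) (x \in lp_comp g).
Proof. exact: asboolP. Qed.

Lemma monomialB a b g : monomial a g - monomial b g = monomial (a - b) g.
Proof. by apply: val_inj; rewrite /= !rmorphB mulrBl. Qed.

Lemma monomial0 g : monomial 0 g = 0.
Proof. by apply: val_inj; rewrite /= rmorph0 mul0r. Qed.

Lemma lp_mul_comp g h x y :
  x \in lp_comp g -> y \in lp_comp h -> x * y \in lp_comp (g + h).
Proof.
move=> /lp_compP[a ->] /lp_compP[b ->]; apply/lp_compP.
have [e eE] := monomial_valM g h; exists (a * b * e); apply: val_inj.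
by rewrite /= mulrACA eE !rmorphM /= !mulrA.
Qed.

Lemma lp_unit_comp g x : x \in lp_comp g -> x != 0 -> x \is a GRing.unit.
Proof.
move=> /lp_compP[a ->] x0; have a0 : a != 0.
  by apply: contra_neq x0 => ->; exact: monomial0.
have gz : g \is a Num.int.
  apply: contra_neqT x0 => gN; apply: val_inj.
  by rewrite /= /monomial_val (negPf gN) mulr0.
apply: (@lp_unitPl _ (monomial a^-1 (- g))); apply: val_inj.
rewrite /= -(numqK gz) -mulrNz !monomial_val_int mulrACA.
rewrite -expfzDr ?laurent_var_neq0 //.
by rewrite addNr expr0z mulr1 -!rmorphM /= mulVf.
Qed.

Lemma lp_spanning (x : laurentPoly) :
  exists (s : seq rat) (f : rat -> laurentPoly),
  [/\ uniq s, forall g, f g \in lp_comp g & x = \sum_(g <- s) f g].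
Proof.
have /laurentP[n [p xp]] := valP x.
(* When x t^n = p, the coefficient of X^i in p belongs to degree i - n. *)
exists [seq (i%:Z - n%:Z)%:~R | i <- iota 0 (size p)].
exists (fun g => monomial p`_`|(numq g + n)%R| g); split.
- rewrite map_inj_uniq ?iota_uniq // => i j /intr_inj /addIr.
  exact: (can_inj absz_nat).
- by move=> g; apply/lp_compP; exists p`_`|(numq g + n)%R|.
- apply: val_inj; rewrite raddf_sum /= big_map.
  apply: (mulIf (expf_neq0 n laurent_var_neq0)); rewrite [LHS]xp mulr_suml.
  rewrite -[p in LHS]coefK poly_def raddf_sum -(big_mkord xpredT
    (fun i => (p`_i *: 'X^i)%:F)) /= /index_iota subn0; apply: eq_bigr => i _.
  rewrite monomial_val_int numq_int subrK absz_nat -mul_polyC tofracM tofracXn.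
  rewrite -mulrA; congr (_ * _).
  by rewrite -[t ^+ n]/(t ^ n) -expfzDr ?laurent_var_neq0 ?subrK.
Qed.

Lemma lp_independent (s : seq rat) (f : rat -> laurentPoly) : uniq s ->
  (forall g, f g \in lp_comp g) -> \sum_(g <- s) f g = 0 ->
  forall g, g \in s -> f g = 0.
Proof.
move=> us fC f0 g gs.
have /choice[a aE] : forall h, exists a, f h = monomial a h.
  by move=> h; exact/lp_compP.
have [gz|gN] := boolP (g \is a Num.int); last first.
  by rewrite aE; apply: val_inj; rewrite /= /monomial_val (negPf gN) mulr0.
suff a0 : a g = 0 by rewrite aE a0 monomial0.
(* Multiplication by t^N makes all exponents occurring in the sum nonnegative, so that coefficients
   of polynomials can be compared. *)
pose N : nat := \sum_(h <- s) `|numq h|%N.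
have leN h : h \in s -> 0 <= numq h + N :> int.
  move=> hs; have : (`|numq h|%N <= N)%N by rewrite /N (big_rem h) //= leq_addr.
  lia.
pose Q h : {poly rat} := if h \is a Num.int then 'X^`|(numq h + N)%R| else 0.
have QE h : h \in s -> monomial_val h * t ^+ N = (Q h)%:F.
  move=> hs; rewrite /monomial_val /Q; case: ifP => _; last by rewrite mul0r rmorph0.
  rewrite tofracXn [t ^+ N]exprnP [t ^+ absz _]exprnP -expfzDr ?laurent_var_neq0 //.
  by rewrite (gez0_abs (leN _ hs)).
have : \sum_(h <- s) a h *: Q h = 0.
  apply/eqP; rewrite -tofrac_eq0 raddf_sum; apply/eqP.
  transitivity (val (\sum_(h <- s) f h) * t ^+ N); last by rewrite f0 mul0r.
  rewrite [val _]raddf_sum mulr_suml; apply: eq_big_seq => h hs.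
  by rewrite /= aE /= -mulrA QE // -tofracM mul_polyC.
move=> /(congr1 (fun p : {poly rat} => p`_`|(numq g + N)%R|)).
rewrite coef0 coef_sum (big_rem g) //= big1_seq ?addr0 => [|h /=].
  by rewrite /Q gz coefZ coefXn eqxx mulr1.
rewrite mem_rem_uniq // inE => /andP[hg hs]; rewrite coefZ /Q.
case: ifP => hz; last by rewrite coef0 mulr0.
rewrite coefXn; case: eqP => [gh|_]; last by rewrite mulr0.
case/eqP: hg; rewrite -(numqK hz) -(numqK gz); congr _%:~R.
have := leN _ hs; have := leN _ gs; lia.
Qed.

Fact rat_divisible n (x : rat) : (0 < n)%N -> exists y : rat, y *+ n = x.
Proof.
move=> n0; exists (x / n%:R); rewrite -[LHS]mulr_natr divfK //.
by rewrite Num.Theory.pnatr_eq0 -lt0n.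
Qed.

Fact rat_torsion_free n (x : rat) : (0 < n)%N -> x *+ n = 0 -> x = 0.
Proof. by case: n => // n _ /eqP; rewrite Num.Theory.mulrn_eq0 => /eqP. Qed.

HB.instance Definition _ :=
  isDivisibleTorsionFree.Build rat rat_divisible rat_torsion_free.

Fact lp_grading : @is_grading rat laurentPoly lp_comp.
Proof.
split; [|exact: lp_spanning|exact: lp_independent].
move=> g; split; first by apply/lp_compP; exists 0; rewrite monomial0.
move=> x y /lp_compP[a ->] /lp_compP[b ->]; apply/lp_compP; exists (a - b).
exact: monomialB.
Qed.

Fact lp_one : 1 \in lp_comp 0.
Proof.
apply/lp_compP; exists 1; apply: val_inj.
by rewrite /= (monomial_val_int 0) expr0z rmorph1 mulr1.
Qed.

Definition laurentField : gradedField rat :=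
  GradedField lp_grading lp_one lp_mul_comp lp_unit_comp.

Lemma laurent_grade_set (g : rat) :
  grade_set laurentField g <-> g \is a Num.int.
Proof.
split=> [[x /lp_compP[a ->]]|gz].
  apply: contraNT => gN; apply/eqP/val_inj.
  by rewrite /= /monomial_val (negPf gN) mulr0.
exists (monomial 1 g); first by apply/lp_compP; exists 1.
apply/eqP => /(congr1 val) /= /eqP; rewrite rmorph1 mul1r /monomial_val gz.
by apply/negP; rewrite expfz_neq0 ?laurent_var_neq0.
Qed.

Lemma laurent_degree0_anisotropic (a b : F0 laurentField) :
  a ^+ 2 + b ^+ 2 = 0 -> a = 0.
Proof.
have /lp_compP[x aE] := valP a; have /lp_compP[y bE] := valP b.
move=> /(congr1 val); rewrite rmorphD !rmorphXn /= [F0_val a]aE [F0_val b]bE.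
move=> /(congr1 val) /= /eqP; rewrite (monomial_val_int 0) expr0z !mulr1.
rewrite -!rmorphM -!rmorphD tofrac_eq0 polyC_eq0 -!expr2.
rewrite Num.Theory.paddr_eq0 ?Num.Theory.sqr_ge0 // !sqrf_eq0.
by move=> /andP[/eqP x0 _]; apply: val_inj; rewrite aE x0 monomial0.
Qed.

End Laurent.

(** * Two choices that differ by signs *)

Section Choices.
Variables (G : dtfGroupType) (F : gradedField G).

Lemma gradeCoset_inhabited (D : gradeCoset F) : exists g, sval D g.
Proof.
case: D => A /= [g Fg ->]; exists (g + 0); exists 0 => //.
exact: double_grade_set0.
Qed.

Definition choice_delta (D : gradeCoset F) : G :=
  if pselect (sval D = double_grade_set F) then 0
  else sval (cid (gradeCoset_inhabited D)).

Definition choice_pi (D : gradeCoset F) : F :=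
  if pselect (sval D = double_grade_set F) then 1
  else homog_unit F (choice_delta D).

Lemma choice_trivial D :
  sval D = double_grade_set F -> choice_delta D = 0 /\ choice_pi D = 1.
Proof. by move=> DD; rewrite /choice_pi /choice_delta; case: pselect. Qed.

Lemma choice_delta_in D : sval D (choice_delta D).
Proof.
rewrite /choice_delta; case: pselect => [DD|_] /=.
  by rewrite DD; exact: double_grade_set0.
exact: svalP (cid _).
Qed.

Lemma choice_pi_in D : choice_pi D \in gf_comp F (choice_delta D).
Proof.
rewrite /choice_pi; case: pselect => [DD|_] /=.
  by rewrite (choice_trivial DD).1 gf_one.
by apply: homog_unit_in; exact: gradeCoset_grade_set (choice_delta_in D).
Qed.

Lemma choice_pi_neq0 D : choice_pi D != 0.
Proof.
rewrite /choice_pi; case: pselect => _ /=; first exact: oner_neq0.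
by apply: contraTneq (homog_unit_unit F (choice_delta D)) => ->; rewrite unitr0.
Qed.

Definition some_choice : cosetChoice F :=
  CosetChoice choice_delta_in choice_pi_in choice_pi_neq0 choice_trivial.

Section Twist.
Variable c : cosetChoice F.

(** The sign is left alone on 2 Gamma_F, where the value 1 is prescribed. *)
Definition twist_pi (D : gradeCoset F) : F :=
  if pselect (sval D = double_grade_set F) then cc_pi c D else - cc_pi c D.

Lemma twist_pi_in D : twist_pi D \in gf_comp F (cc_delta c D).
Proof.
rewrite /twist_pi; case: pselect => _ /=; first exact: cc_pi_in.
by apply: (gradingN (gf_grading F)); exact: cc_pi_in.
Qed.

Lemma twist_pi_neq0 D : twist_pi D != 0.
Proof.
by rewrite /twist_pi; case: pselect => _ /=; rewrite ?oppr_eq0 cc_pi_neq0.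
Qed.

Lemma twist_trivial D :
  sval D = double_grade_set F -> cc_delta c D = 0 /\ twist_pi D = 1.
Proof.
by move=> DD; have [d0 p1] := cc_trivial c DD; rewrite /twist_pi; case: pselect.
Qed.

Definition twist_choice : cosetChoice F :=
  CosetChoice (cc_delta_in c) twist_pi_in twist_pi_neq0 twist_trivial.

Lemma residue_twist (q : gradedQuadSpace F) (D : gradeCoset F) :
  sval D <> double_grade_set F ->
  qs_isometric (residue twist_choice q D) (qs_opp (residue c q D)).
Proof.
move=> DN; exists id; split=> //; first by exists id.
move=> x; apply: val_inj; rewrite /= /twist_pi; case: pselect => // _ /=.
by rewrite invrN mulNr.
Qed.

(* The 1-dimensional form pi_delta x^2 has residues x^2 and - x^2. *)
Lemma twist_residue_map_neq (D : gradeCoset F)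
    (phi1 phi2 : graded_witt_group false F -> residue_witt_group false F) :
  sval D <> double_grade_set F ->
  (forall a b : F0 F, a ^+ 2 + b ^+ 2 = 0 -> a = 0) ->
  is_residue_isomorphism c phi1 -> is_residue_isomorphism twist_choice phi2 ->
  exists w, phi1 w <> phi2 w.
Proof.
move=> DN anis [_ [adm1 phi1E]] [_ [adm2 phi2E]].
pose M : 'M[F0 F]_1 := 1%:M.
have ME (x : 'rV[F0 F]_1) : mx_form M x = x 0 0 ^+ 2.
  by rewrite /mx_form mulmx1 mxE big_ord1 mxE expr2.
have nM : nonsingular (mx_form M).
  (* The Gram matrix is 2, which is nonzero because 1^2 + 1^2 = 0 would contradict anisotropy. *)
  apply: mx_form_nonsingular; rewrite trmx1 -raddfD unitmxE det_scalar1.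
  rewrite unitfE; apply/eqP => two0; have := anis 1 1.
  by rewrite expr1n => /(_ two0) /eqP; rewrite oner_eq0.
have aq := lift_quad_adm (even := false) c D nM (fun e => False_ind _ (notF e)).
pose q : gnsForm F false := exist _ _ aq.
exists (@witt_class (gnsForm_system F false) q) => phi12.
pose r : nsForm_system (F0 F) false := exist _ _ (adm1 q D).
have ar : qs_adm false (qs_opp (sval r)).
  by have [nr dr] := svalP r; split=> //; exact: nonsingular_opp.
pose r' : nsForm_system (F0 F) false := exist _ _ ar.
have rr' : witt_class r = witt_class r'.
  rewrite -[LHS]phi1E phi12 phi2E; apply: witt_class_isom.
  exact: residue_twist.
(* If r and -r have the same class, then r _|_ r has the class of r _|_ -r, which is zero; but r _|_
   r is a nonzero anisotropic form. *)
have : witt_class (fs_sum r r) = cm_zero :> witt_group _.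
  rewrite [LHS]witt_classD [in X in witt_add _ X]rr' -witt_classD.
  by apply: witt_class_hyperbolic; exact: qs_sum_opp_hyperbolic (svalP r).
move=> /witt_class_eq0[h [h' [hh hh' iso]]].
have [f fP] := residue_lift_quad c D M.
have [fl [g fK gK] _] := fP; have [_ _ gE] := isometry_inv fK gK fP.
have rE (x : sval r) : qs_form x = g x 0 0 ^+ 2 by rewrite -ME [RHS]gE.
have r0 (x : sval r) : g x 0 0 = 0 -> x = 0.
  move=> x0; rewrite -[x]gK (_ : g x = 0) ?linear_map0 //.
  by apply/rowP => i; rewrite ord1 x0 mxE.
have r_anis (x : qs_sum (sval r) (sval r)) : qs_form x = 0 -> x = 0.
  case: x => x y /= xy0; have {}xy0 : g x 0 0 ^+ 2 + g y 0 0 ^+ 2 = 0.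
    by rewrite -!rE.
  have x0 := anis _ _ xy0; rewrite addrC in xy0; have y0 := anis _ _ xy0.
  by rewrite (r0 x) // (r0 y).
have arr : qs_adm false (qs_sum (sval r) (sval r)) := svalP (fs_sum r r).
have := anisotropic_witt_trivial arr (svalP h) hh hh' iso r_anis (f 1%:M, 0).
move=> [/(congr1 g)]; rewrite fK => /(congr1 (fun x : 'rV_1 => x 0 0)).
have -> : g 0 = 0 by rewrite -(linear_map0 fl) fK.
by rewrite !mxE eqxx => /eqP; rewrite oner_eq0.
Qed.

End Twist.
End Choices.

Theorem theorem2 :
  (forall (G : dtfGroupType) (F : gradedField G) (c : cosetChoice F),
    [/\ forall (q : gradedQuadSpace F) (D : gradeCoset F),
          gq_adm false q -> qs_adm false (residue c q D),
        exists phi : graded_witt_group false F -> residue_witt_group false F,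
          is_residue_isomorphism c phi
      & (2%:R = 0 :> F) \/ grade_set F = double_grade_set F ->
        exists phi : graded_witt_group true F -> residue_witt_group true F,
          is_residue_isomorphism c phi]) /\
  (exists (G : dtfGroupType) (F : gradedField G) (c1 c2 : cosetChoice F),
    (forall D : gradeCoset F, cc_delta c1 D = cc_delta c2 D) /\
    forall phi1 phi2 : graded_witt_group false F -> residue_witt_group false F,
      is_residue_isomorphism c1 phi1 -> is_residue_isomorphism c2 phi2 ->
      exists w, phi1 w <> phi2 w).
Proof.
split=> [G F c|].
  split=> [q D|| char2_or_div]; first exact: residue_adm.
    have radm (q : gnsForm F false) D : qs_adm false (residue c (sval q) D).
      exact: residue_adm (svalP q).
    by exists (residue_map radm); exact: residue_map_isomorphism.
  have radm (q : gnsForm F true) D : qs_adm true (residue c (sval q) D).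
    exact: residue_adm_even char2_or_div (svalP q).
  by exists (residue_map radm); exact: residue_map_isomorphism.
pose c := some_choice laurentField.
exists rat, laurentField, c, (twist_choice c); split=> // phi1 phi2.
have F1 : grade_set laurentField (1 : rat) by apply/laurent_grade_set.
have [D D1] := ex_gradeCoset F1.
apply: (twist_residue_map_neq (D := D)); last exact: laurent_degree0_anisotropic.
(* Here Gamma_F consists of the integers, and 1 is not twice an integer, so the coset of 1 is not
   the trivial one. *)
move=> DD; move: D1; rewrite DD => -[g /laurent_grade_set gz g1].
have : (numq g *+ 2)%:~R = 1%:~R :> rat by rewrite rmorphMn /= numqK.
by move=> /intr_inj; lia.
Qed.
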